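(* Let $m\in\mathbb N$. For $f\in\mathbb Z^{m+\infty}_+$ let $f^\natural\in\mathbb Z^{m|\infty}_+$ be defined by $f^\natural(i)=f(i)$ for $i<0$, and $f^\natural(1)<f^\natural(2)<\cdots$ the increasing enumeration of $\mathbb Z\setminus\{f(1),f(2),\dots\}$. The map $1\otimes C$ induces a well-defined isomorphism of $\mathcal U$-modules $\natural:\widehat{\mathcal E}^{m+\infty}\to\widehat{\mathcal E}^{m|\infty}$ with the following properties: (1) $\natural(\mathcal K_f)=K_{f^\natural}$ for every $f\in\mathbb Z^{m+\infty}_+$; (2) $\natural(\bar u)=\overline{\natural(u)}$ for every $u\in\widehat{\mathcal E}^{m+\infty}$; (3) $\natural(\mathcal L_f)=L_{f^\natural}$ for every $f\in\mathbb Z^{m+\infty}_+$; (4) $\natural(\mathcal U_f)=U_{f^\natural}$ for every $f\in\mathbb Z^{m+\infty}_+$.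
   Context: Quantum group: $U_q(\mathfrak{gl}(\infty))$ is the $\mathbb Q(q)$-algebra generated by $E_a,F_a,K_a^{\pm1}$ ($a\in\mathbb Z$) with relations $K_aK_a^{-1}=1$, $K_aK_b=K_bK_a$, $K_aE_bK_a^{-1}=q^{\delta_{a,b}-\delta_{a,b+1}}E_b$, $K_aF_bK_a^{-1}=q^{\delta_{a,b+1}-\delta_{a,b}}F_b$, $E_aF_b-F_bE_a=\delta_{a,b}(K_{a,a+1}-K_{a+1,a})/(q-q^{-1})$ with $K_{a,b}=K_aK_b^{-1}$, $E_aE_b=E_bE_a$ and $F_aF_b=F_bF_a$ for $|a-b|>1$, and $E_a^2E_b+E_bE_a^2=(q+q^{-1})E_aE_bE_a$, $F_a^2F_b+F_bF_a^2=(q+q^{-1})F_aF_bF_a$ for $|a-b|=1$. $\mathcal U$ is the subalgebra generated by $E_a,F_a,K_{a,a+1}$ ($a\in\mathbb Z$). Tensor products of modules are formed with $\Delta(E_a)=1\otimes E_a+E_a\otimes K_{a+1,a}$, $\Delta(F_a)=F_a\otimes1+K_{a,a+1}\otimes F_a$, $\Delta(K_a)=K_a\otimes K_a$. The bar map on $\mathcal U$ is the ring automorphism with $\bar q=q^{-1}$, $\bar E_a=E_a$, $\bar F_a=F_a$, $\bar K_a=K_a^{-1}$; a map $\phi$ of $\mathbb Q(q)$-spaces is anti-linear if $\phi(cu)=\bar c\phi(u)$ with $\bar c(q)=c(q^{-1})$. Wedge modules: $\Lambda^m\mathbb V$ has basis $v_{a_1}\wedge\cdots\wedge v_{a_m}$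 ($a_1>\cdots>a_m$ integers) and $\Lambda^\infty\mathbb V$ has basis $v_{a_1}\wedge v_{a_2}\wedge\cdots$ ($a_1>a_2>\cdots$, $a_i=1-i$ for $i\gg0$); on a basis vector with index set $S$, $F_a$ replaces the index $a$ by $a+1$ if $a\in S,a+1\notin S$ (else gives $0$), $E_a$ replaces $a+1$ by $a$ if $a+1\in S,a\notin S$ (else $0$), and $K_{a,a+1}$ acts by $q^{[a\in S]-[a+1\in S]}$. $\Lambda^\infty\mathbb W$ has basis $w_{b_1}\wedge w_{b_2}\wedge\cdots$ ($b_1<b_2<\cdots$, $b_i=i$ for $i\gg0$); for index set $S$, $F_a$ replaces $a+1$ by $a$ if $a+1\in S,a\notin S$ (else $0$), $E_a$ replaces $a$ by $a+1$ if $a\in S,a+1\notin S$ (else $0$), $K_{a,a+1}$ acts by $q^{[a+1\in S]-[a\in S]}$. For a partition $\lambda$ with conjugate $\lambda'$ put $|\lambda\rangle=v_{\lambda_1}\wedge v_{\lambda_2-1}\wedge v_{\lambda_3-2}\wedge\cdots$ and $|\lambda'_*\rangle=w_{1-\lambda'_1}\wedge w_{2-\lambda'_2}\wedge\cdots$; $C:\Lambda^\infty\mathbb V\to\Lambda^\infty\mathbb W$ is the linear map $|\lambda\rangle\mapsto|\lambda'_*\rangle$ (a $\mathcal U$-module isomorphism). Fock spaces: $I(m|\infty)=\{-m,\dots,-1\}\cup\{1,2,\dots\}$. $\mathbb Z^{m+\infty}_+$ is the set of $f:I(m|\infty)\to\mathbb Z$ with $f(-m)>\cdots>f(-1)$,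 $f(1)>f(2)>\cdots$, $f(i)=1-i$ for $i\gg0$; $\mathbb Z^{m|\infty}_+$ the set of $f$ with $f(-m)>\cdots>f(-1)$, $f(1)<f(2)<\cdots$, $f(i)=i$ for $i\gg0$. $\mathcal E^{m+\infty}=\Lambda^m\mathbb V\otimes\Lambda^\infty\mathbb V$ with basis $\mathcal K_f=v_{f(-m)}\wedge\cdots\wedge v_{f(-1)}\otimes v_{f(1)}\wedge v_{f(2)}\wedge\cdots$ ($f\in\mathbb Z^{m+\infty}_+$), and $\mathcal E^{m|\infty}=\Lambda^m\mathbb V\otimes\Lambda^\infty\mathbb W$ with basis $K_f=v_{f(-m)}\wedge\cdots\wedge v_{f(-1)}\otimes w_{f(1)}\wedge w_{f(2)}\wedge\cdots$ ($f\in\mathbb Z^{m|\infty}_+$). $\widehat{\mathcal E}^{m+\infty}$ consists of formal sums $\sum c_f\mathcal K_f$ such that for each $n$ only finitely many $f$ with $c_f\neq0$ have $f(k)=1-k$ for all $k>n$; $\widehat{\mathcal E}^{m|\infty}$ consists of formal sums $\sum c_fK_f$ such that for each $d\in\mathbb N$ only finitely many $f$ with $c_f\ne0$ have $f(i)\ge-d$ for all $i>0$. Orderings: the Bruhat ordering on functions $I(m|\infty)\to\mathbb Z$ is the transitive closure of $f<f\cdot\tau_{ij}$ whenever $i<j$ in $I(m|\infty)$ and $f(i)<f(j)$ ($\tau_{ij}$ the transposition, $(f\cdot\tau)(k)=f(\tau(k))$); $f\in\mathbb Z^{m+\infty}_+$ is J-typical if it is minimal in $\mathbb Z^{m+\infty}_+$.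 For the super ordering let $d_i:I(m|\infty)\to\mathbb Z$, $j\mapsto-\mathrm{sgn}(i)\delta_{ij}$; write $f\downarrow g$ if $g=f-d_i+d_j$ for some $i<0<j$ with $f(i)=f(j)$, or $g=f\cdot\tau_{ij}$ for some $i<j<0$ with $f(i)>f(j)$, or $g=f\cdot\tau_{ij}$ for some $0<i<j$ with $f(i)<f(j)$; $\succ$ is the transitive closure of $\downarrow$. $f\in\mathbb Z^{m|\infty}_+$ is typical if $\{f(-m),\dots,f(-1)\}\cap\{f(1),f(2),\dots\}=\emptyset$. Bar involutions and canonical bases: the bar involution on $\widehat{\mathcal E}^{m+\infty}$ is the unique continuous anti-linear map with $\overline{\mathcal K_f}=\mathcal K_f$ for J-typical $f$, $\overline{Xu}=\bar X\bar u$ ($X\in\mathcal U$), which is an involution and satisfies $\overline{\mathcal K_f}\in\mathcal K_f+$ (possibly infinite) $\mathbb Z[q,q^{-1}]$-combination of $\mathcal K_g$, $g<f$. $\mathcal U_f,\mathcal L_f$ ($f\in\mathbb Z^{m+\infty}_+$) are the unique bar-invariant elements with $\mathcal U_f\in\mathcal K_f+\widehat\sum_{g<f}q\mathbb Z[q]\mathcal K_g$, $\mathcal L_f\in\mathcal K_f+\widehat\sum_{g<f}q^{-1}\mathbb Z[q^{-1}]\mathcal K_g$. Analogously on $\widehat{\mathcal E}^{m|\infty}$ (typical in place of J-typical, $\prec$ in place of $<$) one has the bar involution and $U_f,L_f$ ($f\in\mathbb Z^{m|\infty}_+$). *)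

(* Defs.v *)
From HB Require Import structures.
From mathcomp Require Import all_boot all_order all_algebra.
From mathcomp Require Import fraction generic_quotient.
From Stdlib Require Import ClassicalEpsilon Relation_Operators.
From Stdlib Require List.
Set Implicit Arguments. Unset Strict Implicit. Unset Printing Implicit Defensive.
Import Order.TTheory GRing.Theory Num.Theory.
Local Open Scope ring_scope.

Definition K : fieldType := {fraction {poly rat}}.
Definition qK : K := tofrac ('X : {poly rat}).

Definition evinv (p : {poly rat}) : K :=
  (map_poly (fun c : rat => tofrac (c%:P)) p).[qK^-1].

Definition barK (x : K) : K :=
  evinv (\n_(repr x)) / evinv (\d_(repr x)).

Definition evZ (p : {poly int}) (x : K) : K :=
  (map_poly (fun z : int => z%:~R) p).[x].

Definition inLaurentZ (c : K) : Prop :=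
  exists (p : {poly int}) (n : nat), c = evZ p qK / qK ^+ n.
Definition in_qZq (c : K) : Prop := exists p : {poly int}, c = qK * evZ p qK.
Definition in_qinvZqinv (c : K) : Prop :=
  exists p : {poly int}, c = qK^-1 * evZ p qK^-1.

Definition dec (P : Prop) : bool :=
  if excluded_middle_informative P then true else false.
Definition ind (P : Prop) : int := if dec P then 1 else 0.

(* Indices: a function f : I(m|oo) -> Z is encoded by                  *)
(*   lft f = [:: f(-m); ...; f(-1)]   (a sequence of length m)         *)
(*   rgt f k = f(k+1)                 (k : nat)                         *)
Record idx := Idx { lft : seq int ; rgt : nat -> int }.

Definition valid_plus (m : nat) (f : idx) : Prop :=
  size (lft f) = m /\ sorted (fun x y : int => y < x) (lft f) /\
  (forall k, rgt f k.+1 < rgt f k) /\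
  exists N, forall k, (N <= k)%N -> rgt f k = 1 - (k.+1)%:Z.

Definition valid_super (m : nat) (f : idx) : Prop :=
  size (lft f) = m /\ sorted (fun x y : int => y < x) (lft f) /\
  (forall k, rgt f k < rgt f k.+1) /\
  exists N, forall k, (N <= k)%N -> rgt f k = (k.+1)%:Z.

Definition inL (x : int) (f : idx) : Prop := x \in lft f.
Definition inR (x : int) (f : idx) : Prop := exists k, rgt f k = x.

(* Formal (possibly infinite) combinations sum_f c_f K_f               *)
Definition vec := idx -> K.
Definition vzero : vec := fun _ => 0.
Definition vadd (u v : vec) : vec := fun h => u h + v h.
Definition vscale (c : K) (u : vec) : vec := fun h => c * u h.
Definition basis (g : idx) : vec := fun h => if dec (h = g) then 1 else 0.
Definition bv (P : Prop) (g : idx) (c : K) : vec :=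
  fun h => if dec (P /\ h = g) then c else 0.

(* coefficientwise sum of a family of vectors x_f: at each g the sum of
   the (finitely many) nonzero x_f(g); 0 if there are infinitely many *)
Definition fsum (x : idx -> vec) : vec := fun g =>
  match excluded_middle_informative
          (exists l : list idx, List.NoDup l /\
             forall f, List.In f l <-> x f g <> 0) with
  | left H => \sum_(f <- proj1_sig (constructive_indefinite_description _ H)) x f g
  | right _ => 0
  end.

Definition finite_idx (P : idx -> Prop) : Prop :=
  exists l : list idx, forall f, P f -> List.In f l.

Definition tailV (n : nat) (f : idx) : Prop :=
  forall j, (n <= j)%N -> rgt f j = 1 - (j.+1)%:Z.
Definition boundW (d : nat) (f : idx) : Prop :=
  forall j, - (d%:Z) <= rgt f j.

Definition Ehat_plus (m : nat) (u : vec) : Prop :=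
  (forall f, u f <> 0 -> valid_plus m f) /\
  forall n : nat, finite_idx (fun f => u f <> 0 /\ tailV n f).
Definition Ehat_super (m : nat) (u : vec) : Prop :=
  (forall f, u f <> 0 -> valid_super m f) /\
  forall d : nat, finite_idx (fun f => u f <> 0 /\ boundW d f).

(* basic open neighbourhoods of 0 of the linear topologies *)
Definition offV (n : nat) (u : vec) : Prop := forall f, u f <> 0 -> ~ tailV n f.
Definition offW (d : nat) (u : vec) : Prop := forall f, u f <> 0 -> ~ boundW d f.

Inductive gen := GE of int | GF of int | GK of int. (* E_a, F_a, K_{a,a+1} *)

Definition replL (x y : int) (f : idx) : idx :=
  Idx [seq (if z == x then y else z) | z <- lft f] (rgt f).
Definition replR (x y : int) (f : idx) : idx :=
  Idx (lft f) (fun k => if rgt f k == x then y else rgt f k).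

(* K_{a,a+1} on a V-type, resp. W-type, basis vector with index set S *)
Definition kV (a : int) (S : int -> Prop) : K := qK ^ (ind (S a) - ind (S (a + 1))).
Definition kW (a : int) (S : int -> Prop) : K := qK ^ (ind (S (a + 1)) - ind (S a)).

(* on L^m V (x) L^oo V, with Delta(E_a)=1(x)E_a+E_a(x)K_{a+1,a},
   Delta(F_a)=F_a(x)1+K_{a,a+1}(x)F_a, Delta(K_a)=K_a(x)K_a *)
Definition actb_plus (X : gen) (f : idx) : vec :=
  match X with
  | GE a => vadd (bv (inR (a + 1) f /\ ~ inR a f) (replR (a + 1) a f) 1)
                 (bv (inL (a + 1) f /\ ~ inL a f) (replL (a + 1) a f)
                     (kV a (fun x => inR x f))^-1)
  | GF a => vadd (bv (inL a f /\ ~ inL (a + 1) f) (replL a (a + 1) f) 1)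
                 (bv (inR a f /\ ~ inR (a + 1) f) (replR a (a + 1) f)
                     (kV a (fun x => inL x f)))
  | GK a => vscale (kV a (fun x => inL x f) * kV a (fun x => inR x f)) (basis f)
  end.

Definition actb_super (X : gen) (f : idx) : vec :=
  match X with
  | GE a => vadd (bv (inR a f /\ ~ inR (a + 1) f) (replR a (a + 1) f) 1)
                 (bv (inL (a + 1) f /\ ~ inL a f) (replL (a + 1) a f)
                     (kW a (fun x => inR x f))^-1)
  | GF a => vadd (bv (inL a f /\ ~ inL (a + 1) f) (replL a (a + 1) f) 1)
                 (bv (inR (a + 1) f /\ ~ inR a f) (replR (a + 1) a f)
                     (kV a (fun x => inL x f)))
  | GK a => vscale (kV a (fun x => inL x f) * kW a (fun x => inR x f)) (basis f)
  end.

Definition act_plus (X : gen) (u : vec) : vec :=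
  fsum (fun f => vscale (u f) (actb_plus X f)).
Definition act_super (X : gen) (u : vec) : vec :=
  fsum (fun f => vscale (u f) (actb_super X f)).

(* positions of I(m|oo): PL i is -m+i (i < m), PR j is j+1 *)
Inductive pos := PL of nat | PR of nat.
Definition pos_lt (p p' : pos) : bool :=
  match p, p' with
  | PL i, PL j => (i < j)%N
  | PL _, PR _ => true
  | PR _, PL _ => false
  | PR i, PR j => (i < j)%N
  end.
Definition pos_ok (m : nat) (p : pos) : Prop :=
  match p with PL i => (i < m)%N | PR _ => True end.
Definition pval (f : idx) (p : pos) : int :=
  match p with PL i => nth 0 (lft f) i | PR j => rgt f j end.
Definition pset (f : idx) (p : pos) (v : int) : idx :=
  match p with
  | PL i => Idx (set_nth 0 (lft f) i v) (rgt f)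
  | PR j => Idx (lft f) (fun k => if k == j then v else rgt f k)
  end.
Definition swap (f : idx) (i j : pos) : idx :=
  pset (pset f i (pval f j)) j (pval f i).

Definition bru_step (m : nat) (f g : idx) : Prop :=
  size (lft f) = m /\
  exists i j, pos_ok m i /\ pos_ok m j /\ pos_lt i j /\
              pval f i < pval f j /\ g = swap f i j.
Definition bru_lt (m : nat) (g f : idx) : Prop := clos_trans idx (bru_step m) g f.

Definition Jtypical (m : nat) (f : idx) : Prop :=
  valid_plus m f /\ forall g, valid_plus m g -> ~ bru_lt m g f.

(* d_i(i) = - sgn(i) *)
Definition dval (p : pos) : int := match p with PL _ => 1 | PR _ => -1 end.

Definition down (m : nat) (f g : idx) : Prop :=
  size (lft f) = m /\
  [\/ (exists i j, (i < m)%N /\ pval f (PL i) = pval f (PR j) /\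
        g = pset (pset f (PL i) (pval f (PL i) - dval (PL i)))
                 (PR j) (pval f (PR j) + dval (PR j))),
      (exists i j, (i < j < m)%N /\ pval f (PL i) > pval f (PL j) /\
        g = swap f (PL i) (PL j))
    | (exists i j, (i < j)%N /\ pval f (PR i) < pval f (PR j) /\
        g = swap f (PR i) (PR j))].
Definition super_gt (m : nat) (f g : idx) : Prop := clos_trans idx (down m) f g.

Definition typical (m : nat) (f : idx) : Prop :=
  valid_super m f /\ forall x, inL x f -> ~ inR x f.

Definition is_bar_plus (m : nat) (b : vec -> vec) : Prop :=
  (forall u, Ehat_plus m u -> Ehat_plus m (b u)) /\
  (forall u v, Ehat_plus m u -> Ehat_plus m v -> b (vadd u v) = vadd (b u) (b v)) /\
  (forall c u, Ehat_plus m u -> b (vscale c u) = vscale (barK c) (b u)) /\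
  (forall n', exists n, forall u, Ehat_plus m u -> offV n u -> offV n' (b u)) /\
  (forall f, Jtypical m f -> b (basis f) = basis f) /\
  (* bar(Xu) = bar(X) bar(u) for the generators X (bar K_{a,a+1} = K_{a,a+1}^{-1}) *)
  (forall u a, Ehat_plus m u ->
        [/\ b (act_plus (GE a) u) = act_plus (GE a) (b u),
            b (act_plus (GF a) u) = act_plus (GF a) (b u) &
            act_plus (GK a) (b (act_plus (GK a) u)) = b u]) /\
  (forall u, Ehat_plus m u -> b (b u) = u) /\
  (forall f, valid_plus m f ->
        b (basis f) f = 1 /\
        forall g, g <> f -> b (basis f) g <> 0 ->
          bru_lt m g f /\ inLaurentZ (b (basis f) g)).

Definition is_bar_super (m : nat) (b : vec -> vec) : Prop :=
  (forall u, Ehat_super m u -> Ehat_super m (b u)) /\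
  (forall u v, Ehat_super m u -> Ehat_super m v -> b (vadd u v) = vadd (b u) (b v)) /\
  (forall c u, Ehat_super m u -> b (vscale c u) = vscale (barK c) (b u)) /\
  (forall d', exists d, forall u, Ehat_super m u -> offW d u -> offW d' (b u)) /\
  (forall f, typical m f -> b (basis f) = basis f) /\
  (forall u a, Ehat_super m u ->
        [/\ b (act_super (GE a) u) = act_super (GE a) (b u),
            b (act_super (GF a) u) = act_super (GF a) (b u) &
            act_super (GK a) (b (act_super (GK a) u)) = b u]) /\
  (forall u, Ehat_super m u -> b (b u) = u) /\
  (forall f, valid_super m f ->
        b (basis f) f = 1 /\
        forall g, g <> f -> b (basis f) g <> 0 ->
          super_gt m f g /\ inLaurentZ (b (basis f) g)).

Definition isU_plus (m : nat) (b : vec -> vec) (f : idx) (x : vec) : Prop :=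
  [/\ Ehat_plus m x, b x = x, x f = 1 &
      forall g, g <> f -> x g <> 0 -> bru_lt m g f /\ in_qZq (x g)].
Definition isL_plus (m : nat) (b : vec -> vec) (f : idx) (x : vec) : Prop :=
  [/\ Ehat_plus m x, b x = x, x f = 1 &
      forall g, g <> f -> x g <> 0 -> bru_lt m g f /\ in_qinvZqinv (x g)].
Definition isU_super (m : nat) (b : vec -> vec) (f : idx) (x : vec) : Prop :=
  [/\ Ehat_super m x, b x = x, x f = 1 &
      forall g, g <> f -> x g <> 0 -> super_gt m f g /\ in_qZq (x g)].
Definition isL_super (m : nat) (b : vec -> vec) (f : idx) (x : vec) : Prop :=
  [/\ Ehat_super m x, b x = x, x f = 1 &
      forall g, g <> f -> x g <> 0 -> super_gt m f g /\ in_qinvZqinv (x g)].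

Definition compl_enum (r : nat -> int) : nat -> int :=
  match excluded_middle_informative
          (exists r' : nat -> int, (forall k, r' k < r' k.+1) /\
             forall z, (exists k, r' k = z) <-> ~ (exists k, r k = z)) with
  | left H => proj1_sig (constructive_indefinite_description _ H)
  | right _ => fun _ => 0
  end.

Definition fnat (f : idx) : idx := Idx (lft f) (compl_enum (rgt f)).

(* conjugate partition: lam i = lambda_{i+1};
   conjp lam j = #{ i >= 1 | lambda_i >= j } *)
Definition conjp (lam : nat -> int) (j : int) : nat :=
  match excluded_middle_informative
          (exists l : seq nat, uniq l /\ forall i, i \in l <-> j <= lam i) with
  | left H => size (proj1_sig (constructive_indefinite_description _ H))
  | right _ => 0%N
  end.

(* C on index data: v_{a_1} /\ v_{a_2} /\ ... = |lambda> with
   lambda_i = a_i - 1 + i  is sent to |lambda'_*> = w_{b_1} /\ w_{b_2} /\ ...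
   with b_j = j - lambda'_j *)
Definition Cr (r : nat -> int) : nat -> int :=
  fun k => (k.+1)%:Z - (conjp (fun i => r i + i%:Z) (k.+1)%:Z)%:Z.
Definition cmap (f : idx) : idx := Idx (lft f) (Cr (rgt f)).

Definition natural (u : vec) : vec :=
  fsum (fun f => vscale (u f) (basis (cmap f))).

(* Main.v *)
Require Import Defs.
From HB Require Import structures.
From mathcomp Require Import all_boot all_order all_algebra.
From mathcomp Require Import zify.
From Stdlib Require Import ClassicalEpsilon FunctionalExtensionality.
From Stdlib Require Import Relation_Operators Operators_Properties.
From Stdlib Require List.

(** On basis vectors [natural] is the bijection that replaces the index set of
    the semi-infinite factor by its complement, so everything formal (bijectivity,
    linearity, the module structure) is checked on the basis.

    Compatibility with the bar involutions: call [u] intertwined if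
    [natural (b1 u) = b2 (natural u)]. Intertwined vectors form a closed subspace,
    stable under [E_a] and [F_a], which contains the typical basis vectors (fixed
    by both bars). That it contains every [K_f] goes by induction on the degree of
    atypicality [#(L \ R)], where [L], [R] are the index sets of the two factors.
    Let [a + 1] be the least element of [L \ R] and look at [a]:
    - if [a] is in neither [L] nor [R], or in both, then [K_f] is exactly [F_a] or
      [E_a] applied to a basis vector whose least atypical entry is [a];
    - if [a] is in [R] only, then [K_f = F_a K_g - c K_h] with [g] less atypical and
      [a] the least atypical entry of [h].
    Once [a] is below [L] and inside the sea only the last case occurs, and iterating
    it writes [K_f] as a convergent series of intertwined vectors; the remaining
    finitely many values of [a] are handled by induction upwards.

    For the canonical bases one also needs that [g < f] in the Bruhat ordering
    implies [g^nat] below [f^nat] in the super ordering. Bruhat steps preserve the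
    multiset of values and can only decrease the left entries in the dominance sense;
    conversely a dominance relation is realised by successively lowering one left
    entry from [a] to [b], and such a move is a chain of super steps: move [a] past
    the intermediate entries on both sides, then lower the pair [(a, a)] to [(b, b)]. *)

Set Implicit Arguments. Unset Strict Implicit. Unset Printing Implicit Defensive.
Import Order.TTheory GRing.Theory Num.Theory.
Local Open Scope ring_scope.

(** * Coefficientwise sums *)

Lemma decP (P : Prop) : reflect P (dec P).
Proof. by rewrite /dec; case: excluded_middle_informative => ?; constructor. Qed.

HB.instance Definition _ := hasDecEq.Build idx (fun f g => decP (f = g)).

Lemma InP (T : eqType) (x : T) l : List.In x l <-> x \in l.
Proof.
elim: l => [|y l IH] //=; rewrite inE; split.
  by case=> [->|/IH ->]; rewrite ?eqxx ?orbT.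
by case/orP=> [/eqP ->|/IH]; [left|right].
Qed.

Lemma NoDupP (T : eqType) (l : seq T) : List.NoDup l <-> uniq l.
Proof.
elim: l => [|y l IH] /=; first by split=> // _; constructor.
split=> [H|/andP[yl /IH ul]]; last by constructor => // /InP; apply/negP.
inversion H; subst; rewrite (proj1 IH) // andbT; apply/negP => /InP; auto.
Qed.

Section Fsum.
Implicit Types (x y : idx -> vec) (g h : idx).

Lemma fsumE x g l : uniq l -> (forall f, x f g <> 0 -> f \in l) ->
  fsum x g = \sum_(f <- l) x f g.
Proof.
move=> ul sl; rewrite /fsum; case: excluded_middle_informative => [H|[]].
  case: constructive_indefinite_description => l' /= [/NoDupP ul' sl'].
  rewrite [RHS](bigID (fun f => x f g == 0)) /= [X in _ = X + _]big1 ?add0r => [|f /eqP //].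
  rewrite -(big_filter l (fun f => x f g != 0)); apply: perm_big; apply: uniq_perm; rewrite ?filter_uniq //.
  move=> f; rewrite mem_filter; apply/idP/andP.
    by move=> /InP/sl' nz; split; [apply/eqP|apply: sl].
  by case=> /eqP nz _; apply/InP/sl'.
exists [seq f <- l | x f g != 0]; split; first by apply/NoDupP; rewrite filter_uniq.
move=> f; split=> [/InP|nz]; first by rewrite mem_filter => /andP[/eqP].
by apply/InP; rewrite mem_filter sl // andbT; apply/eqP.
Qed.

Lemma fsum_inf x g : ~ (exists l : seq idx, forall f, x f g <> 0 -> f \in l) ->
  fsum x g = 0.
Proof.
move=> H; rewrite /fsum; case: excluded_middle_informative => [E|//].
by case: H; case: E => l [_ Hl]; exists l => f /Hl/InP.
Qed.

Lemma fsum_neq0 x g : fsum x g <> 0 -> exists f, x f g <> 0.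
Proof.
move=> nz; apply: NNPP => H; apply: nz.
rewrite (@fsumE _ _ [::]) ?big_nil // => f nz; case: H; by exists f.
Qed.

Lemma fsum1 x g f : (forall f', x f' g <> 0 -> f' = f) -> fsum x g = x f g.
Proof.
by move=> H; rewrite (@fsumE _ _ [:: f]) ?big_seq1 // => f' /H ->; rewrite inE eqxx.
Qed.

Lemma fsum_reindex (P : idx -> Prop) (phi psi : idx -> idx) x y g h :
  (forall f, P f -> psi (phi f) = f) ->
  (forall f, x f g <> 0 -> P f) ->
  (forall f, P f -> y (phi f) h = x f g) ->
  (forall w, y w h <> 0 -> exists2 f, P f & w = phi f) ->
  fsum y h = fsum x g.
Proof.
move=> phiK xP yx yP.
case: (excluded_middle_informative
  (exists l : seq idx, forall f, x f g <> 0 -> f \in l)) => [[l0 Hl0]|H].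
  pose l := undup [seq f <- l0 | dec (P f)].
  have Hl f : x f g <> 0 -> f \in l.
    by move=> nz; rewrite mem_undup mem_filter Hl0 // andbT; apply/decP/xP.
  have lP f : f \in l -> P f by rewrite mem_undup mem_filter => /andP[/decP].
  rewrite (fsumE (undup_uniq _) Hl) (@fsumE _ _ (map phi l)).
  - by rewrite big_map [LHS]big_seq [RHS]big_seq; apply: eq_bigr => f /lP Pf; rewrite yx.
  - rewrite map_inj_in_uniq ?undup_uniq // => f f' /lP Pf /lP Pf' E.
    by rewrite -(phiK f) // E phiK.
  - move=> w nz; case: (yP w nz) => f Pf Ew; rewrite Ew map_f //; apply: Hl.
    by rewrite -yx // -Ew.
rewrite !fsum_inf // => -[l Hl]; apply: H; exists (map psi l) => f nz.
have Pf := xP _ nz; rewrite -(phiK f) // map_f //; apply: Hl; by rewrite yx.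
Qed.
End Fsum.

(** * Increasing and decreasing enumerations *)

Section Enumerations.
Implicit Types (r s : nat -> int).

Definition incr s := forall k, s k < s k.+1.
Definition decr r := forall k, r k.+1 < r k.
Definition vsea r := decr r /\ exists N, forall k, (N <= k)%N -> r k = 1 - (k.+1)%:Z.
Definition wsea s := incr s /\ exists N, forall k, (N <= k)%N -> s k = (k.+1)%:Z.
Definition ran r (x : int) := exists k, r k = x.

Lemma incr_lt s : incr s -> forall i j, (i < j)%N -> s i < s j.
Proof.
move=> H i j; elim: j => // j IH; rewrite ltnS leq_eqVlt => /orP[/eqP ->|/IH lt] //.
exact: lt_trans lt (H j).
Qed.

Lemma incr_ltE s : incr s -> forall i j, (s i < s j) = (i < j)%N.
Proof.
move=> H i j; apply/idP/idP => [|/(incr_lt H)//].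
by case: ltngtP => // [/(incr_lt H) lt1 lt2|->]; [have := lt_trans lt1 lt2|]; rewrite ltxx.
Qed.

Lemma incr_inj s : incr s -> injective s.
Proof.
move=> H i j E; case: (ltngtP i j) => // /(incr_lt H); by rewrite E ltxx.
Qed.

Lemma incrN r : decr r -> incr (fun k => 1 - r k).
Proof. by move=> H k; have := H k; lia. Qed.

Lemma decr_lt r : decr r -> forall i j, (i < j)%N -> r j < r i.
Proof. by move=> /incrN/incr_lt H i j /H; lia. Qed.

Lemma decr_inj r : decr r -> injective r.
Proof. by move=> /incrN/incr_inj H i j E; apply: H; rewrite E. Qed.

Lemma incr_ext s s' : incr s -> incr s' -> (forall x, ran s x <-> ran s' x) -> s = s'.
Proof.
move=> H H' E; apply: functional_extensionality => k.
elim/ltn_ind: k => k IH; apply/eqP; rewrite eq_le; apply/andP; split.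
  have [i Ei] : ran s (s' k) by apply/E; exists k.
  rewrite -Ei leNgt incr_ltE //; apply/negP => lt.
  have := incr_lt H' lt; by rewrite -IH // Ei ltxx.
have [i Ei] : ran s' (s k) by apply/E; exists k.
rewrite -Ei leNgt incr_ltE //; apply/negP => lt.
have := incr_lt H lt; by rewrite IH // Ei ltxx.
Qed.

Lemma decr_ext r r' : decr r -> decr r' -> (forall x, ran r x <-> ran r' x) -> r = r'.
Proof.
move=> H H' E; have : (fun k => 1 - r k) = (fun k => 1 - r' k).
  apply: incr_ext; [exact: incrN|exact: incrN|move=> x].
  split=> -[k Ek]; [case: (proj1 (E (r k))) | case: (proj2 (E (r' k)))];
   (try by exists k); move=> i Ei; exists i; rewrite Ei //.
move=> EE; apply: functional_extensionality => k; have := f_equal (@^~ k) EE => /=; lia.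
Qed.

Lemma conjpE lam (j : int) n : (forall i, j <= lam i <-> (i < n)%N) -> conjp lam j = n.
Proof.
move=> H; rewrite /conjp; case: excluded_middle_informative => [E|[]]; last first.
  by exists (iota 0 n); split=> [|i]; [exact: iota_uniq|rewrite mem_iota /= add0n; apply: iff_sym].
case: constructive_indefinite_description => l /= [ul Hl].
rewrite -(size_iota 0 n); apply/eqP; rewrite -uniq_size_uniq ?iota_uniq //.
by move=> i; rewrite mem_iota /= add0n; apply/idP/idP => [/H/Hl|/Hl/H].
Qed.

Section Partition.
Variables (r : nat -> int) (Hr : vsea r).

(* [lam i] is the part lambda_(i+1) of the partition attached to [r]. *)
Let lam i := r i + i%:Z.

Lemma lam_le i j : (i <= j)%N -> lam j <= lam i.
Proof.
case: Hr => [d _]; move=> ij; rewrite -(subnK ij); elim: (j - i)%N => // k IH.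
by have := d (k + i)%N; move: IH; rewrite /lam addSn; lia.
Qed.

Lemma lam_ge0 i : 0 <= lam i.
Proof.
case: Hr => [d [N HN]]; have := lam_le (leq_maxl i N).
by rewrite {1}/lam HN ?leq_maxr //; lia.
Qed.

Lemma conjp_lam j : 0 < j -> forall i, (j <= lam i) = (i < conjp lam j)%N.
Proof.
move=> j0; case: Hr => [d [N HN]].
have ex : exists i, lam i < j by exists N; rewrite /lam HN //; lia.
have /conjpE -> : forall i, j <= lam i <-> (i < ex_minn ex)%N.
  move=> i; case: ex_minnP => n ln nmin; split.
    by rewrite ltnNge => le; apply/negP => /lam_le; lia.
  by move=> lt; rewrite leNgt; apply/negP => /nmin; lia.
move=> i; case: ex_minnP => n ln nmin; apply/idP/idP.
  by rewrite ltnNge => le; apply/negP => /lam_le; lia.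
by move=> lt; rewrite leNgt; apply/negP => /nmin; lia.
Qed.

Lemma Cr_wsea : wsea (Cr r).
Proof.
have CrE k : Cr r k = k.+1%:Z - (conjp lam k.+1%:Z)%:Z by [].
split.
  move=> k; rewrite !CrE; suff : (conjp lam k.+2%:Z <= conjp lam k.+1%:Z)%N by lia.
  rewrite leqNgt -conjp_lam //; apply/negP => H.
  have : k.+2%:Z <= lam (conjp lam k.+1%:Z) by move: H; lia.
  have := conjp_lam (isT : 0 < k.+1%:Z) (conjp lam k.+1%:Z); rewrite ltnn; lia.
case: Hr => [d [N HN]].
exists `|lam 0|%N => k le; rewrite CrE; suff -> : conjp lam k.+1%:Z = 0%N by lia.
have := conjp_lam (isT : 0 < k.+1%:Z) 0%N; have := lam_ge0 0; lia.
Qed.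

Lemma ran_Cr x : ran (Cr r) x <-> ~ ran r x.
Proof.
have [d _] := Hr; split.
  case=> k Ek [i Ei]; have := conjp_lam (isT : 0 < k.+1%:Z) i.
  move: Ek; rewrite /Cr -/lam -Ei /lam; lia.
move=> nx; have ex : exists i, r i < x.
  by exists `|x - lam 0|.+1; have := lam_le (leq0n `|x - lam 0|.+1); rewrite {1}/lam; lia.
pose n := ex_minn ex.
have Hn i : (x < r i) = (i < n)%N.
  rewrite /n; case: ex_minnP => n0 ln nmin; apply/idP/idP.
    rewrite ltnNge => lt; apply/negP; rewrite leq_eqVlt => /orP[/eqP E|/(decr_lt d)]; last by lia.
    by move: ln; rewrite E; lia.
  move=> lt; case: (ltgtP x (r i)) => // [/nmin|E]; first by lia.
  by case: nx; exists i.
have rn : r n < x by rewrite /n; case: ex_minnP.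
have := lam_ge0 n; rewrite /lam => ln.
exists (absz (x + n%:Z - 1)%R); rewrite /Cr -/lam.
have -> : ((absz (x + n%:Z - 1)%R).+1)%:Z = x + n%:Z by lia.
rewrite (@conjpE _ _ n); first by lia.
move=> i; split=> H.
  by rewrite ltnNge; apply/negP => /lam_le; move: H; rewrite /lam; lia.
have : x < r n.-1 by rewrite Hn; lia.
have : lam n.-1 <= lam i by apply: lam_le; lia.
rewrite /lam; lia.
Qed.

Lemma compl_enum_Cr : compl_enum r = Cr r.
Proof.
have [ir _] := Cr_wsea.
rewrite /compl_enum; case: excluded_middle_informative => [H|[]]; last first.
  by exists (Cr r); split=> // x; apply: ran_Cr.
case: constructive_indefinite_description => s /= [is_ Hs].
by apply: incr_ext => // x; rewrite ran_Cr; apply: Hs.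
Qed.
End Partition.

(* x |-> 1 - x exchanges the two vacua, hence reduces the inverse of [Cr] to [Cr]. *)
Definition Cr_inv s : nat -> int := fun k => 1 - Cr (fun i => 1 - s i) k.

Lemma vseaN s : wsea s -> vsea (fun k => 1 - s k).
Proof.
by case=> d [N HN]; split=> [k|]; [have := d k; lia|exists N => k /HN ->].
Qed.

Lemma ranN s x : ran (fun k => 1 - s k) x <-> ran s (1 - x).
Proof. by split=> -[k Ek]; exists k; lia. Qed.

Lemma Cr_inv_vsea s : wsea s -> vsea (Cr_inv s).
Proof.
by move=> /vseaN/Cr_wsea [d [N HN]]; split=> [k|];
  [have := d k; rewrite /Cr_inv; lia|exists N => k /HN; rewrite /Cr_inv => ->].
Qed.

Lemma ran_Cr_inv s x : wsea s -> ran (Cr_inv s) x <-> ~ ran s x.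
Proof.
move=> Hs; rewrite ranN ran_Cr; last exact: vseaN.
by rewrite ranN (_ : 1 - (1 - x) = x) //; lia.
Qed.

Lemma ran_Cr_invN s x : wsea s -> ~ ran (Cr_inv s) x <-> ran s x.
Proof. by move=> Hs; rewrite ran_Cr_inv //; split=> [/NNPP|H []]. Qed.

Lemma Cr_invK s : wsea s -> Cr (Cr_inv s) = s.
Proof.
move=> Hs; have V := Cr_inv_vsea Hs; apply: incr_ext.
- by case: (Cr_wsea V).
- by case: Hs.
- by move=> x; rewrite ran_Cr // ran_Cr_invN.
Qed.

Lemma CrK r : vsea r -> Cr_inv (Cr r) = r.
Proof.
move=> Hr; have W := Cr_wsea Hr; apply: decr_ext.
- by case: (Cr_inv_vsea W).
- by case: Hr.
- by move=> x; rewrite ran_Cr_inv // ran_Cr //; split=> [/NNPP|H []].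
Qed.

Lemma vsea_tail r n : vsea r ->
  (forall x : int, x <= - n%:Z -> ran r x) <-> (forall j, (n <= j)%N -> r j = 1 - j.+1%:Z).
Proof.
move=> Hr; split=> [H j|H x le]; last by exists `|x|%N; rewrite H; lia.
have [d [N HN]] := Hr.
have [k] : exists k, (N <= j + k)%N by exists N; lia.
elim: k j => [|k IH] i le ni; first by apply: HN; lia.
have Ei : r i.+1 = 1 - i.+2%:Z by apply: IH; lia.
have [l El] : ran r (- i%:Z) by apply: H; lia.
have : l = i; last by move=> E; move: El; rewrite E; lia.
have := lam_ge0 Hr i => g.
case: (ltngtP l i) => // [/(decr_lt d)|]; first by rewrite El; lia.
rewrite leq_eqVlt => /orP[/eqP E|/(decr_lt d)]; last by lia.
by move: Ei; rewrite E El; lia.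
Qed.
End Enumerations.

(** * The map on basis vectors *)

Definition adj (x y : int) := y = x + 1 \/ x = y + 1.

Lemma adjC x y : adj x y -> adj y x.
Proof. by case; [right|left]. Qed.

Lemma adj_neq x y : adj x y -> x <> y.
Proof. by rewrite /adj; lia. Qed.

Section Replace.
Variables (x y : int) (xy : adj x y).
Implicit Types (r : nat -> int).

Definition repl r : nat -> int := fun k => if r k == x then y else r k.

Lemma ran_repl r z : ran r x -> ran (repl r) z <-> z = y \/ (ran r z /\ z <> x).
Proof.
move=> [k0 E0]; rewrite /repl; split.
  by case=> k; case: eqP => [_ <-|nx <-]; [left|right; split=> //; exists k].
case=> [->|[[k Ek] nx]]; first by exists k0; rewrite E0 eqxx.
by exists k; case: eqP => // E; case: nx; rewrite -Ek.
Qed.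

Lemma decr_repl r : decr r -> ~ ran r y -> decr (repl r).
Proof.
move=> d ny k; rewrite /repl; have := d k.
have : r k <> y by move=> E; apply: ny; exists k.
have : r k.+1 <> y by move=> E; apply: ny; exists k.+1.
by move: xy; rewrite /adj; case: eqP; case: eqP; lia.
Qed.

Lemma incr_repl r : incr r -> ~ ran r y -> incr (repl r).
Proof.
move=> d ny k; rewrite /repl; have := d k.
have : r k <> y by move=> E; apply: ny; exists k.
have : r k.+1 <> y by move=> E; apply: ny; exists k.+1.
by move: xy; rewrite /adj; case: eqP; case: eqP; lia.
Qed.

Lemma vsea_repl r : vsea r -> ~ ran r y -> vsea (repl r).
Proof.
move=> [d [N HN]] ny; split; first exact: decr_repl.
exists (N + absz x).+2 => k le; rewrite /repl HN; last by lia.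
by case: eqP => //; lia.
Qed.

Lemma sorted_repl (l : seq int) : sorted (fun a b : int => b < a) l -> y \notin l ->
  sorted (fun a b : int => b < a) [seq (if z == x then y else z) | z <- l].
Proof.
move=> sl ny.
have H (a b : int) : a != y -> b != y -> b < a ->
    (if b == x then y else b) < (if a == x then y else a).
  move=> /eqP na /eqP nb; move: xy; rewrite /adj; case: eqP; case: eqP; lia.
apply: (homo_sorted_in (P := mem l) _ _ sl); last exact/allP.
by move=> a b al bl; apply: H; apply: memPn ny _ _.
Qed.

Lemma mem_repl (l : seq int) z : x \in l -> y \notin l ->
  (z \in [seq (if z == x then y else z) | z <- l]) = (z == y) || (z \in l) && (z != x).
Proof.
move=> xl ny; apply/mapP/orP => [[a al ->]|].
  by case: (a =P x) => [_|/eqP ax]; [left; rewrite eqxx|right; rewrite al].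
case=> [/eqP ->|/andP[zl /negPf nx]]; first by exists x; rewrite ?eqxx.
by exists z; rewrite ?nx.
Qed.
End Replace.

Section Indices.
Variable m : nat.
Implicit Types (f g w : idx) (u v : vec).

Lemma valid_vsea f : valid_plus m f -> vsea (rgt f).
Proof. by case=> _ []. Qed.

Lemma valid_wsea f : valid_super m f -> wsea (rgt f).
Proof. by case=> _ []. Qed.

Lemma valid_cmap f : valid_plus m f -> valid_super m (cmap f).
Proof. by case=> sf [lf rf]; do 2!split=> //; apply: Cr_wsea. Qed.

Definition cinv w := Idx (lft w) (Cr_inv (rgt w)).

Lemma valid_cinv w : valid_super m w -> valid_plus m (cinv w).
Proof. by case=> sf [lf rf]; do 2!split=> //; apply: Cr_inv_vsea. Qed.

Lemma cmapK f : valid_plus m f -> cinv (cmap f) = f.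
Proof. by move=> /valid_vsea; case: f => l r Hr; rewrite /cinv CrK. Qed.

Lemma cinvK w : valid_super m w -> cmap (cinv w) = w.
Proof. by move=> /valid_wsea; case: w => l r Hr; rewrite /cmap Cr_invK. Qed.

Lemma cmap_inj f g : valid_plus m f -> valid_plus m g -> cmap f = cmap g -> f = g.
Proof. by move=> vf vg E; rewrite -(cmapK vf) E cmapK. Qed.

Lemma inR_cmap f x : valid_plus m f -> inR x (cmap f) <-> ~ inR x f.
Proof. by move=> /valid_vsea Hr; apply: ran_Cr. Qed.

Lemma inR_cmapN f x : valid_plus m f -> ~ inR x (cmap f) <-> inR x f.
Proof. by move=> vf; rewrite inR_cmap //; split=> [/NNPP|H []]. Qed.

Lemma fnat_cmap f : valid_plus m f -> fnat f = cmap f.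
Proof. by move=> /valid_vsea Hr; rewrite /fnat compl_enum_Cr. Qed.

Lemma gt_sorted_ext (l l' : seq int) :
  sorted (fun a b : int => b < a) l -> sorted (fun a b : int => b < a) l' ->
  l =i l' -> l = l'.
Proof.
apply: irr_sorted_eq => [a b c /= ab bc|a /=]; [exact: lt_trans bc ab|exact: ltxx].
Qed.

Lemma valid_plus_ext f g : valid_plus m f -> valid_plus m g ->
  (forall x, inL x f <-> inL x g) -> (forall x, inR x f <-> inR x g) -> f = g.
Proof.
move=> [_ [sf [df _]]] [_ [sg [dg _]]] EL ER.
have El : lft f = lft g by apply: gt_sorted_ext => // x; apply/idP/idP => /EL.
have Er := decr_ext df dg ER.
by move: El Er; clear; case: f g => l r [l' r'] /= -> ->.
Qed.

Lemma valid_uniq f : valid_plus m f -> uniq (lft f).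
Proof.
case=> _ [sf _]; apply: sorted_uniq sf => [a b c /= ab bc|a /=]; last exact: ltxx.
exact: lt_trans bc ab.
Qed.

Lemma tailVE f n : valid_plus m f -> tailV n f <-> forall x : int, x <= - n%:Z -> inR x f.
Proof. by move=> /valid_vsea Hr; split=> /(vsea_tail _ Hr). Qed.

Lemma tailV_cmap f n : valid_plus m f ->
  tailV n f <-> forall j, 1 - n%:Z <= rgt (cmap f) j.
Proof.
move=> vf; rewrite tailVE //; split=> [H j|H x le].
  rewrite leNgt; apply/negP => lt.
  have : inR (rgt (cmap f) j) (cmap f) by exists j.
  by rewrite inR_cmap // => -[]; apply: H; lia.
by apply/(inR_cmapN _ vf) => -[j Ej]; have := H j; lia.
Qed.

Lemma inL_replL f x y z : inL x f -> ~ inL y f ->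
  inL z (replL x y f) <-> z = y \/ (inL z f /\ z <> x).
Proof.
rewrite /inL /= => xf yf; rewrite mem_repl //; last exact/negP.
split=> [/orP[/eqP|/andP[-> /eqP]]|[->|[-> /eqP ->]]]; rewrite ?eqxx ?orbT; by [left|right|].
Qed.

Lemma inR_replR f x y z : inR x f -> inR z (replR x y f) <-> z = y \/ (inR z f /\ z <> x).
Proof. by move=> xf; apply: ran_repl. Qed.

Lemma valid_replL f x y : adj x y -> valid_plus m f -> ~ inL y f -> valid_plus m (replL x y f).
Proof.
move=> a [sf [lf rf]] ny; split; first by rewrite size_map.
by split=> //; apply: sorted_repl => //; apply/negP.
Qed.

Lemma valid_replR f x y : adj x y -> valid_plus m f -> ~ inR y f -> valid_plus m (replR x y f).
Proof. by move=> a [sf [lf rf]] ny; do 2!split=> //; apply: vsea_repl. Qed.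

Lemma cmap_replR f x y : adj x y -> valid_plus m f -> inR x f -> ~ inR y f ->
  cmap (replR x y f) = replR y x (cmap f).
Proof.
move=> a vf xf yf; have vr := valid_replR a vf yf.
suff E : Cr (rgt (replR x y f)) = repl y x (Cr (rgt f)) by rewrite /cmap E.
apply: incr_ext.
- by case: (Cr_wsea (valid_vsea vr)).
- apply: (incr_repl (adjC a)); first by case: (Cr_wsea (valid_vsea vf)).
  by rewrite ran_Cr; [apply|apply: valid_vsea].
move=> z; have xy := adj_neq a.
have xr : ran (rgt f) x := xf.
have yr : ~ ran (rgt f) y := yf.
have E : ran (rgt (replR x y f)) z <-> z = y \/ (ran (rgt f) z /\ z <> x).
  exact: inR_replR.
rewrite (ran_Cr (valid_vsea vr)) ran_repl ?(ran_Cr (valid_vsea vf)) // E.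
by case: (z =P x) => [?|?]; case: (z =P y) => [?|?]; try subst z; tauto.
Qed.

Lemma basisE f : basis f f = 1.
Proof. by rewrite /basis; case: decP. Qed.

Lemma basis_neq f g : g <> f -> basis f g = 0.
Proof. by rewrite /basis; case: decP. Qed.

Lemma basis_supp f g : basis f g <> 0 -> g = f.
Proof. by rewrite /basis; case: decP. Qed.

Lemma natural_cmap u f : (forall g, u g <> 0 -> valid_plus m g) -> valid_plus m f ->
  natural u (cmap f) = u f.
Proof.
move=> su vf; rewrite /natural (@fsum1 _ _ f) /vscale ?basisE ?mulr1 // => g nz.
have ug : u g <> 0 by move=> E; apply: nz; rewrite E mul0r.
apply: cmap_inj => //; first exact: su.
by symmetry; apply: basis_supp => E; apply: nz; rewrite E mulr0.
Qed.

Lemma natural_supp u w : (forall g, u g <> 0 -> valid_plus m g) -> natural u w <> 0 ->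
  exists2 f, u f <> 0 & w = cmap f.
Proof.
move=> su /fsum_neq0 [f nz]; exists f; first by move=> E; apply: nz; rewrite /vscale E mul0r.
by apply: basis_supp => E; apply: nz; rewrite /vscale E mulr0.
Qed.

Lemma natural_unique u v : (forall g, u g <> 0 -> valid_plus m g) ->
  (forall w, v w <> 0 -> valid_super m w) ->
  (forall f, valid_plus m f -> v (cmap f) = u f) -> natural u = v.
Proof.
move=> su sv E; apply: functional_extensionality => w.
case: (excluded_middle_informative (valid_super m w)) => [vw|nv].
  by rewrite -(cinvK vw) natural_cmap // ?E //; apply: valid_cinv.
have -> : v w = 0 by apply: NNPP => /sv.
apply: NNPP => /(natural_supp su) [f /su vf Ew]; apply: nv; rewrite Ew; exact: valid_cmap.
Qed.

Lemma Ehat_natural u : Ehat_plus m u -> Ehat_super m (natural u).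
Proof.
move=> [su fu]; split; first by move=> w /(natural_supp su) [f /su vf ->]; apply: valid_cmap.
move=> d; have [l Hl] := fu d.+1; exists (map cmap l) => w [nz bd].
have [f uf Ew] := natural_supp su nz; apply/List.in_map_iff; exists f; split=> //.
apply: Hl; split=> //; apply/(tailV_cmap _ (su _ uf)) => j.
by have := bd j; rewrite Ew; lia.
Qed.

Lemma natural_inj u v : Ehat_plus m u -> Ehat_plus m v -> natural u = natural v -> u = v.
Proof.
move=> [su _] [sv _] E; apply: functional_extensionality => f.
case: (excluded_middle_informative (valid_plus m f)) => [vf|nv].
  by rewrite -(natural_cmap su vf) E natural_cmap.
have -> : v f = 0 by apply: NNPP => /sv.
by apply: NNPP => /su.
Qed.

Lemma natural_surj (w : vec) : Ehat_super m w -> exists u, Ehat_plus m u /\ natural u = w.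
Proof.
move=> [sw fw]; pose u : vec := fun f => if dec (valid_plus m f) then w (cmap f) else 0.
have uE f : valid_plus m f -> u f = w (cmap f) by rewrite /u; case: decP.
have su f : u f <> 0 -> valid_plus m f by rewrite /u; case: decP.
exists u; split; last by apply: natural_unique => // f /uE.
split=> // n; have [l Hl] := fw n; exists (map cinv l) => f [nz tf].
have vf := su _ nz; apply/List.in_map_iff; exists (cmap f); split; first exact: cmapK.
apply: Hl; split; first by rewrite -uE.
by move=> j; have := proj1 (tailV_cmap n vf) tf j; lia.
Qed.

Lemma vadd_supp (P : idx -> Prop) u v : (forall g, u g <> 0 -> P g) ->
  (forall g, v g <> 0 -> P g) -> forall g, vadd u v g <> 0 -> P g.
Proof.
move=> su sv g nz; apply: NNPP => nP; apply: nz; rewrite /vadd.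
have -> : u g = 0 by apply: NNPP => /su.
have -> : v g = 0 by apply: NNPP => /sv.
exact: addr0.
Qed.

Lemma vscale_supp c u g : vscale c u g <> 0 -> u g <> 0.
Proof. by move=> nz E; apply: nz; rewrite /vscale E mulr0. Qed.

Lemma naturalD u v : Ehat_plus m u -> Ehat_plus m v ->
  natural (vadd u v) = vadd (natural u) (natural v).
Proof.
move=> Hu Hv; have [[su _] [sv _]] := (Hu, Hv); apply: natural_unique.
- exact: vadd_supp.
- by case: (Ehat_natural Hu) => su' _; case: (Ehat_natural Hv) => sv' _; apply: vadd_supp.
- by move=> f vf; rewrite /vadd !natural_cmap.
Qed.

Lemma naturalZ c u : Ehat_plus m u -> natural (vscale c u) = vscale c (natural u).
Proof.
move=> Hu; have [su _] := Hu; apply: natural_unique.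
- by move=> g /vscale_supp/su.
- by move=> g /vscale_supp; case: (Ehat_natural Hu) => su' _; apply: su'.
- by move=> f vf; rewrite /vscale natural_cmap.
Qed.

Lemma basis_Ehat f : valid_plus m f -> Ehat_plus m (basis f).
Proof.
move=> vf; split=> [g /basis_supp -> //|n].
by exists [:: f] => g [/basis_supp -> _]; left.
Qed.

Lemma natural_basis f : valid_plus m f -> natural (basis f) = basis (cmap f).
Proof.
move=> vf; apply: natural_unique.
- by move=> g /basis_supp ->.
- by move=> g /basis_supp ->; apply: valid_cmap.
- move=> g vg; case: (excluded_middle_informative (g = f)) => [->|ne].
    by rewrite !basisE.
  by rewrite !basis_neq // => /cmap_inj E; apply: ne; apply: E.
Qed.

End Indices.

(** * The module structure *)

Section Action.
Variable m : nat.
Implicit Types (f g w : idx) (u v : vec).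

Lemma adjS a : adj a (a + 1). Proof. by left. Qed.
Lemma adjP a : adj (a + 1) a. Proof. by right. Qed.

Lemma bv_supp P f c g : bv P f c g <> 0 -> P /\ g = f.
Proof. by rewrite /bv; case: decP. Qed.

Lemma bvT (P : Prop) f c : P -> bv P f c = vscale c (basis f).
Proof.
move=> p; apply: functional_extensionality => g; rewrite /bv /vscale /basis.
by case: decP; case: decP; rewrite ?mulr1 ?mulr0 //; tauto.
Qed.

Lemma bvF (P : Prop) f c : ~ P -> bv P f c = vzero.
Proof.
by move=> p; apply: functional_extensionality => g; rewrite /bv; case: decP => // -[].
Qed.

Lemma bv_cmap (P P' : Prop) f w c g : (P' <-> P) ->
  (P -> valid_plus m f /\ cmap f = w) -> valid_plus m g ->
  bv P' w c (cmap g) = bv P f c g.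
Proof.
move=> PP H vg; rewrite /bv; congr (if _ then _ else _); apply/decP/decP.
  by move=> [/PP p E]; split=> //; have [vf Ef] := H p; apply: cmap_inj vg vf _; rewrite E Ef.
by move=> [p E]; split; [apply/PP|rewrite E; case: (H p)].
Qed.

Lemma indN (P : Prop) : ind (~ P) = 1 - ind P.
Proof. by rewrite /ind; case: decP; case: decP. Qed.

Lemma ind_iff (P Q : Prop) : (P <-> Q) -> ind P = ind Q.
Proof. by rewrite /ind => PQ; case: decP => /PQ; case: decP. Qed.

Lemma kW_cmap f a : valid_plus m f ->
  kW a (fun x => inR x (cmap f)) = kV a (fun x => inR x f).
Proof.
move=> vf; rewrite /kW /kV !(ind_iff (inR_cmap _ vf)) !indN; congr (_ ^ _); lia.
Qed.

Lemma replL_ok f x y : adj x y -> valid_plus m f -> ~ inL y f ->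
  valid_plus m (replL x y f) /\ cmap (replL x y f) = replL x y (cmap f).
Proof. by move=> a vf ny; split=> //; apply: valid_replL. Qed.

Lemma replR_ok f x y : adj x y -> valid_plus m f -> inR x f /\ ~ inR y f ->
  valid_plus m (replR x y f) /\ cmap (replR x y f) = replR y x (cmap f).
Proof. by move=> a vf [xf yf]; split; [apply: valid_replR|apply: cmap_replR a vf xf yf]. Qed.

Lemma actb_cmap X f g : valid_plus m f -> valid_plus m g ->
  actb_super X (cmap f) (cmap g) = actb_plus X f g.
Proof.
move=> vf vg; have RN x y : inR y (cmap f) /\ ~ inR x (cmap f) <-> inR x f /\ ~ inR y f.
  by have := inR_cmap x vf; have := inR_cmap y vf; tauto.
case: X => a; rewrite /actb_super /actb_plus /vadd ?kW_cmap //; last first.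
  by rewrite -(natural_basis vf) /vscale (natural_cmap (m := m)) // => h /basis_supp ->.
all: rewrite /=; congr (_ + _).
- by apply: bv_cmap (iff_refl _) _ vg => -[_ H]; apply: replL_ok => //; apply: adjS.
- by apply: bv_cmap (RN _ _) _ vg => H; apply: replR_ok => //; apply: adjS.
- by apply: bv_cmap (RN _ _) _ vg => H; apply: replR_ok => //; apply: adjP.
- by apply: bv_cmap (iff_refl _) _ vg => -[_ H]; apply: replL_ok => //; apply: adjP.
Qed.

Lemma actb_plus_supp X f g : valid_plus m f -> actb_plus X f g <> 0 -> valid_plus m g.
Proof.
move=> vf; case: X => a; last by move=> /vscale_supp/basis_supp ->.
all: apply: vadd_supp g => g /bv_supp [H ->].
- by apply: valid_replR => //; [apply: adjP|case: H].
- by apply: valid_replL => //; [apply: adjP|case: H].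
- by apply: valid_replL => //; [apply: adjS|case: H].
- by apply: valid_replR => //; [apply: adjS|case: H].
Qed.

Lemma actb_super_supp X f w : valid_plus m f -> actb_super X (cmap f) w <> 0 ->
  valid_super m w.
Proof.
move=> vf; case: X => a; last by move=> /vscale_supp/basis_supp ->; apply: valid_cmap.
all: apply: vadd_supp w => w /bv_supp [H ->].
- have [ny xf] : ~ inR a f /\ inR (a + 1) f.
    by move: H; rewrite (inR_cmap _ vf) (inR_cmapN _ vf).
  rewrite -(cmap_replR (adjP a) vf xf ny).
  by apply: valid_cmap; apply: valid_replR => //; apply: adjP.
- by case: H => _ ny; apply: (@valid_cmap m (replL _ _ f)); apply: valid_replL => //; apply: adjP.
- by case: H => _ ny; apply: (@valid_cmap m (replL _ _ f)); apply: valid_replL => //; apply: adjS.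
- have [ny xf] : ~ inR (a + 1) f /\ inR a f.
    by move: H; rewrite (inR_cmap _ vf) (inR_cmapN _ vf).
  rewrite -(cmap_replR (adjS a) vf xf ny).
  by apply: valid_cmap; apply: valid_replR => //; apply: adjS.
Qed.

Lemma natural_act X u : (forall g, u g <> 0 -> valid_plus m g) ->
  natural (act_plus X u) = act_super X (natural u).
Proof.
move=> su; apply: (@natural_unique m).
- by move=> g /fsum_neq0 [f nz]; apply: (actb_plus_supp (X := X) (su f _)) => E;
    apply: nz; rewrite /vscale E ?mul0r ?mulr0.
- move=> w /fsum_neq0 [w' nz].
  have nu : natural u w' <> 0 by move=> E; apply: nz; rewrite /vscale E mul0r.
  have na := vscale_supp nz; have [f uf Ew] := natural_supp su nu; rewrite Ew in na.
  exact: actb_super_supp (su _ uf) na.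
move=> g vg; apply: (fsum_reindex (P := valid_plus m) (phi := cmap) (psi := cinv)).
- exact: cmapK.
- by move=> f nz; apply: su => E; apply: nz; rewrite /vscale E mul0r.
- by move=> f vf; rewrite /vscale actb_cmap // (natural_cmap su).
- move=> w nz; have nu : natural u w <> 0 by move=> E; apply: nz; rewrite /vscale E mul0r.
  by have [f /su vf ->] := natural_supp su nu; exists f.
Qed.

Lemma act_basis X f : act_plus X (basis f) = actb_plus X f.
Proof.
apply: functional_extensionality => g; rewrite /act_plus (@fsum1 _ _ f).
  by rewrite /vscale basisE mul1r.
by move=> f' nz; apply: basis_supp => E; apply: nz; rewrite /vscale E mul0r.
Qed.
End Action.

(** * Invariants of the Bruhat ordering *)

Section BruhatInvariants.
Variable m : nat.
Implicit Types (f g w : idx) (P : pred int).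

Definition cnt P N f := (count P (lft f) + count P (mkseq (rgt f) N))%N.

Definition mult (x : int) f : nat := ((x \in lft f) + dec (inR x f))%N.

Lemma mkseq_upd (r : nat -> int) j v N : (j < N)%N ->
  mkseq (fun k => if k == j then v else r k) N = set_nth 0 (mkseq r N) j v.
Proof.
move=> jN; apply: (@eq_from_nth _ 0) => [|k].
  by rewrite size_set_nth !size_mkseq (maxn_idPr _).
by rewrite size_mkseq => kN; rewrite nth_set_nth /= !nth_mkseq.
Qed.

Definition in_window N f p := match p with PL i => (i < size (lft f))%N | PR j => (j < N)%N end.

Lemma count_set_nthD P (l : seq int) i v : (i < size l)%N ->
  (count P (set_nth 0%R l i v) + P (nth 0%R l i) = count P l + P v)%N.
Proof.
move=> il; rewrite count_set_nth_ltn // subnK // (leq_trans _ (leq_addr _ _)) //.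
by case E: (P (nth 0%R l i)) => //; rewrite -has_count; apply/hasP; exists (nth 0%R l i);
  rewrite ?mem_nth.
Qed.

Lemma cnt_pset P N f p v : in_window N f p ->
  (cnt P N (pset f p v) + P (pval f p) = cnt P N f + P v)%N.
Proof.
case: p => [i|j] /= ok; rewrite /cnt /=.
  by rewrite addnAC count_set_nthD // addnAC.
rewrite mkseq_upd // -(nth_mkseq 0 (rgt f) ok) -addnA count_set_nthD ?size_mkseq //.
by rewrite addnA.
Qed.

Lemma in_window_pset N f p q v : in_window N f p -> in_window N f q ->
  in_window N (pset f p v) q.
Proof. by case: p q => [i|i] [j|j] //= Hi Hj; rewrite size_set_nth leq_max Hj orbT. Qed.

Lemma pval_pset f p q v : p <> q -> pval (pset f p v) q = pval f q.
Proof.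
case: p q => [i|i] [j|j] //= ne; first by rewrite nth_set_nth /=; case: eqP => // E; case: ne; rewrite E.
by case: eqP => // E; case: ne; rewrite E.
Qed.

Lemma cnt_swap P N f p q : p <> q -> in_window N f p -> in_window N f q ->
  cnt P N (swap f p q) = cnt P N f.
Proof.
move=> ne okp okq; rewrite /swap.
have := cnt_pset P (pval f p) (in_window_pset (pval f q) okp okq).
rewrite pval_pset //; have := cnt_pset P (pval f q) okp; lia.
Qed.

Definition bru_inv g f := size (lft g) = size (lft f) /\
  (exists N0, forall N, (N0 <= N)%N -> forall P, cnt P N g = cnt P N f) /\
  forall x : int, (count (fun y => x <= y)%R (lft g) <= count (fun y => x <= y)%R (lft f))%N.

Lemma bru_step_inv g f : bru_step m g f -> bru_inv g f.
Proof.
move=> [sg [p [q [okp [okq [lt [vlt ->]]]]]]].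
have ne : p <> q by move=> E; move: vlt; rewrite E ltxx.
split; last split.
- by case: p q okp okq {lt vlt ne} => [i|i] [j|j] //= oi oj; rewrite !size_set_nth; lia.
- exists (match p with PL _ => 0 | PR i => i.+1 end + match q with PL _ => 0 | PR j => j.+1 end)%N.
  move=> N HN P; rewrite cnt_swap //.
    by case: p okp HN {lt vlt ne} => [i|i] /=; lia.
  by case: q okq HN {lt vlt ne} => [i|i] /=; lia.
move=> x; case: p q okp okq lt vlt ne => [i|i] [j|j] //= oi oj lt vlt ne.
- have E0 := @cnt_swap (fun y => x <= y) 0%N g (PL i) (PL j) ne.
  by move: E0; rewrite /cnt /= !addn0 sg => ->.
- rewrite -(leq_add2r (x <= nth 0 (lft g) i)%R).
  rewrite (@count_set_nthD (fun y => x <= y)) ?sg // leq_add2l.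
  by case: (leP x (nth 0 (lft g) i)) => //= le; rewrite (le_trans le (ltW vlt)).
Qed.

Lemma bru_lt_inv g f : bru_lt m g f -> bru_inv g f.
Proof.
elim=> {g f} [g f|g h f _ [s1 [[N1 H1] d1]] _ [s2 [[N2 H2] d2]]]; first exact: bru_step_inv.
split; first by rewrite s1.
split=> [|x]; last exact: leq_trans (d1 x) (d2 x).
by exists (maxn N1 N2) => N; rewrite geq_max => /andP[l1 l2] P; rewrite H1 ?H2.
Qed.

Lemma cnt_mult f x : valid_plus m f ->
  exists N0, forall N, (N0 <= N)%N -> cnt (pred1 x) N f = mult x f.
Proof.
move=> vf; have [dr _] := valid_vsea vf.
have [N0 HN] : exists N0, forall k, rgt f k = x -> (k < N0)%N.
  case: (excluded_middle_informative (inR x f)) => [[k0 E0]|nx].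
    by exists k0.+1 => k E; rewrite (decr_inj dr (_ : rgt f k = rgt f k0)) ?E.
  by exists 0%N => k E; case: nx; exists k.
exists N0 => N le; rewrite /cnt /mult !count_uniq_mem ?(valid_uniq vf) //; last first.
  by rewrite mkseq_uniq //; apply: decr_inj.
congr (_ + nat_of_bool _)%N; apply/mapP/decP => [[k _ ->]|[k E]]; first by exists k.
by exists k => //; rewrite mem_iota /= add0n; apply: leq_trans (HN _ E) le.
Qed.

Lemma bru_lt_mult g f x : valid_plus m g -> valid_plus m f -> bru_lt m g f ->
  mult x g = mult x f.
Proof.
move=> vg vf /bru_lt_inv [_ [[N0 H] _]].
have [N1 H1] := cnt_mult x vg; have [N2 H2] := cnt_mult x vf.
by rewrite -(H1 (N0 + N1 + N2)%N) -?(H2 (N0 + N1 + N2)%N) ?H //; lia.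
Qed.

Lemma mult_lft_eq f g : valid_plus m f -> valid_plus m g ->
  (forall x, mult x g = mult x f) -> {subset lft f <= lft g} -> g = f.
Proof.
move=> vf vg E sub.
have EL : lft f =i lft g.
  by have [|] := uniq_min_size (valid_uniq vf) sub => //; case: vf vg => -> _ [-> _].
apply: (valid_plus_ext vg vf) => x; first by rewrite /inL EL.
have := E x; rewrite /mult EL => /eqP; rewrite eqn_add2l => /eqP.
by case: decP; case: decP => //; tauto.
Qed.

Lemma bru_lt_typical g f : valid_plus m g -> valid_plus m f -> bru_lt m g f ->
  (forall x, inL x f -> inR x f) -> g = f.
Proof.
move=> vg vf lt LR; have E x := bru_lt_mult x vg vf lt.
apply: mult_lft_eq => // x xf; have := E x; rewrite /mult xf.
by have /decP -> := LR x xf; case: (x \in lft g) => //; case: dec.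
Qed.
End BruhatInvariants.

(** * From the Bruhat ordering to the super ordering *)

Section SuperOrder.
Variable m : nat.
Implicit Types (f g w : idx) (l p c t : seq int) (s : nat -> int).

Lemma nth_mid p (a : int) t : nth 0 (p ++ a :: t) (size p) = a.
Proof. by elim: p. Qed.

Lemma set_nth_mid p (a b : int) t : set_nth 0 (p ++ a :: t) (size p) b = p ++ b :: t.
Proof. by elim: p => //= x p ->. Qed.

Lemma nth_mid_next p (a b : int) t : nth 0 (p ++ a :: b :: t) (size p).+1 = b.
Proof. by elim: p. Qed.

Lemma set_nth_mid_next p (a b d : int) t :
  set_nth 0 (p ++ a :: b :: t) (size p).+1 d = p ++ a :: d :: t.
Proof. by elim: p => //= x p ->. Qed.

Lemma bubble_lft p a c t s : size (p ++ a :: c ++ t) = m -> all (fun x => x < a) c ->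
  clos_refl_trans idx (down m) (Idx (p ++ a :: c ++ t) s) (Idx (p ++ c ++ a :: t) s).
Proof.
elim: c p => [|x c IH] p sz /=; first by move=> _; apply: rt_refl.
move=> /andP[xa ca]; apply: (@rt_trans _ _ _ (Idx ((p ++ [:: x]) ++ a :: c ++ t) s)).
  apply: rt_step; split; first by rewrite /= -sz.
  apply: Or32; exists (size p), (size p).+1; split.
    by move: sz; rewrite /= size_cat /= => <-; lia.
  rewrite /swap /pval /= nth_mid nth_mid_next; split=> //.
  by rewrite set_nth_mid set_nth_mid_next -catA.
have := IH (p ++ [:: x]) _ ca; rewrite -!catA /=; apply.
by rewrite -sz !size_cat /= !size_cat !addnS.
Qed.

Definition insert (i j : nat) s : nat -> int :=
  fun k => if k == i then s j else if (i < k <= j)%N then s k.-1 else s k.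

Lemma bubble_rgt l i j s : size l = m -> (i <= j)%N ->
  (forall k, (i <= k < j)%N -> s k < s j) ->
  clos_refl_trans idx (down m) (Idx l s) (Idx l (insert i j s)).
Proof.
move=> sz; elim: j s => [|j IH] s.
  rewrite leqn0 => /eqP -> _; rewrite (_ : insert 0 0 s = s); first exact: rt_refl.
  by apply: functional_extensionality => k; rewrite /insert; case: eqP => [->|_] //; case: ifP => //; lia.
rewrite leq_eqVlt => /orP[/eqP -> _|ij H].
  rewrite (_ : insert j.+1 j.+1 s = s); first exact: rt_refl.
  by apply: functional_extensionality => k; rewrite /insert; case: eqP => [->|_] //; case: ifP => //; lia.
pose s1 k := if k == j then s j.+1 else if k == j.+1 then s j else s k.
have s1E k : (k < j)%N -> s1 k = s k by rewrite /s1 => lt; do 2 (case: eqP; first by lia).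
apply: (@rt_trans _ _ _ (Idx l s1)).
  apply: rt_step; split=> //; apply: Or33; exists j, j.+1; split=> //.
  split; first by apply: H; lia.
  rewrite /swap /pset /pval /=; congr Idx; apply: functional_extensionality => k; rewrite /s1.
  by case: (k =P j) => [->|nj] //; case: eqP => // E; lia.
rewrite (_ : insert i j.+1 s = insert i j s1); last first.
  apply: functional_extensionality => k; rewrite /insert {1}/s1 eqxx.
  case: (k =P i) => // ki; case: ifP => H1; case: ifP => H2.
  - by rewrite s1E //; lia.
  - by have -> : k = j.+1; [lia|rewrite /s1; case: eqP => [|_]; [lia|rewrite eqxx]].
  - by lia.
  - by rewrite /s1; do 2 (case: eqP; first by lia).
apply: IH => // k Hk; rewrite s1E; last by lia.
by rewrite /s1 eqxx; apply: H; lia.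
Qed.

Definition upd s j v : nat -> int := fun k => if k == j then v else s k.

Lemma lower_pair n i j l s : size l = m -> (i < m)%N -> nth 0 l i = s j ->
  clos_trans idx (down m) (Idx l s)
    (Idx (set_nth 0 l i (s j - n.+1%:Z)) (upd s j (s j - n.+1%:Z))).
Proof.
move=> sz im; elim: n l s sz => [|n IH] l s sz E.
  apply: t_step; split=> //; apply: Or31; exists i, j; split=> //; split=> //.
  by rewrite /pset /= E.
apply: t_trans.
  apply: t_step; split=> //; apply: Or31; exists i, j; split=> //; split=> //.
rewrite /pset /=; set l1 := set_nth _ _ _ _; set s1 := (fun k => _).
have s1j : s1 j = s j - 1 by rewrite /s1 eqxx.
have := IH l1 s1; rewrite s1j set_set_nth eqxx.
have -> : s j - 1 - n.+1%:Z = s j - n.+2%:Z by lia.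
have -> : upd s1 j (s j - n.+2%:Z) = upd s j (s j - n.+2%:Z).
  by apply: functional_extensionality => k; rewrite /upd /s1; case: eqP.
apply; first by rewrite size_set_nth sz (maxn_idPr _).
by rewrite nth_set_nth /= eqxx E.
Qed.

Definition gti := fun x y : int => y < x.

Lemma gti_trans : transitive gti.
Proof. by move=> x y z xy yz; exact: lt_trans yz xy. Qed.

Lemma pairwise_gti_cat l l' : (forall x y, x \in l -> y \in l' -> y < x) ->
  pairwise gti l -> pairwise gti l' -> pairwise gti (l ++ l').
Proof. by move=> H pl pl'; rewrite pairwise_cat pl pl' !andbT; apply/allrelP. Qed.

Lemma pairwise_gti_cons a l : (forall y, y \in l -> y < a) -> pairwise gti l ->
  pairwise gti (a :: l).
Proof. by move=> H pl /=; rewrite pl andbT; apply/allP. Qed.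

Lemma gt_sorted_split l a b : sorted gti l -> a \in l -> b \notin l -> b < a ->
  exists p c t, [/\ l = p ++ a :: c ++ t, all (fun x => x < a) c &
    sorted gti (p ++ c ++ b :: t)].
Proof.
move=> sl al bl ba.
pose p := [seq x <- l | a < x]; pose c := [seq x <- l | b < x < a]; pose t := [seq x <- l | x < b].
have neb x : x \in l -> x <> b by move=> xl E; move: bl; rewrite -E xl.
have pl : pairwise gti l by rewrite -sorted_pairwise //; exact: gti_trans.
have [pp pc pt] : [/\ pairwise gti p, pairwise gti c & pairwise gti t].
  by split; apply: pairwise_filter.
exists p, c, t; split.
- apply: gt_sorted_ext => //.
    rewrite (sorted_pairwise gti_trans); apply: pairwise_gti_cat => // [x y|].
      rewrite mem_filter inE mem_cat !mem_filter => /andP[ax _].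
      by case/orP => [/eqP ->|/orP[]/andP[H _]] //; lia.
    apply: pairwise_gti_cons => [y|].
      by rewrite mem_cat !mem_filter => /orP[]/andP[H _]; lia.
    apply: pairwise_gti_cat => // x y; rewrite !mem_filter => /andP[H1 _] /andP[H2 _]; lia.
  move=> x; rewrite mem_cat inE mem_cat !mem_filter.
  apply/idP/idP => [xl|]; last by case/orP => [|/orP[/eqP ->|/orP[]]] // /andP[].
  by have := neb _ xl; rewrite xl; lia.
- by apply/allP => x; rewrite mem_filter => /andP[/andP[]].
rewrite (sorted_pairwise gti_trans); apply: pairwise_gti_cat => // [x y|].
  rewrite mem_filter mem_cat inE !mem_filter => /andP[ax _].
  by case/orP => [/andP[H _]|/orP[/eqP ->|/andP[H _]]]; lia.
apply: pairwise_gti_cat => // [x y|].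
  rewrite mem_filter inE mem_filter => /andP[H1 _].
  by case/orP => [/eqP ->|/andP[H2 _]]; lia.
by apply: pairwise_gti_cons => // y; rewrite mem_filter => /andP[].
Qed.

Lemma mem_swap_mid p c t (a b x : int) : uniq (p ++ a :: c ++ t) ->
  (x \in p ++ c ++ b :: t) = (x == b) || (x \in p ++ a :: c ++ t) && (x != a).
Proof.
rewrite cat_uniq /= !mem_cat !inE !mem_cat => /and3P[_]; rewrite negb_or => /andP[ap _].
move=> /andP[act _]; case: (x =P a) => [->|_]; last first.
  by rewrite andbT; case: (x \in p); case: (x \in c); case: (x == b).
move: act; rewrite negb_or => /andP[/negPf -> /negPf ->]; rewrite (negPf ap).
by rewrite andbF !orbF.
Qed.

Lemma incr_insert s i j b : incr s -> (i <= j)%N -> (forall k, (k < i)%N -> s k < b) ->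
  b < s i -> incr (upd (insert i j s) i b).
Proof.
move=> is_ ij lo hi k; rewrite /upd /insert.
have := is_ k; have := is_ k.-1.
case: (k =P i) => [->|ki].
  rewrite (_ : (i.+1 == i) = false); last by lia.
  by case: ifP => H; [rewrite /= | have := is_ i; lia].
case: (k.+1 =P i) => [Ei|ki'].
  by have := lo k; rewrite (_ : (i < k <= j)%N = false); lia.
case: ifP => H; case: ifP => H' //=; rewrite ?prednK; try lia.
Qed.

Lemma ran_insert s i j b x : incr s -> (i <= j)%N ->
  ran (upd (insert i j s) i b) x <-> x = b \/ (ran s x /\ x <> s j).
Proof.
move=> is_ ij; split.
  case=> k; rewrite /upd /insert; case: (k =P i) => [_ <-|ki]; first by left.
  case: ifP => H <-; right; (split; first by eexists) => /(incr_inj is_); lia.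
case=> [->|[[k Ek] ne]]; first by exists i; rewrite /upd eqxx.
have kj : k <> j by move=> E; apply: ne; rewrite -Ek E.
case: (boolP (i <= k < j)%N) => H.
  exists k.+1; rewrite /upd /insert (_ : (k.+1 == i) = false); last by lia.
  by rewrite (_ : (i < k.+1 <= j)%N = true) //; lia.
exists k; rewrite /upd /insert (_ : (k == i) = false); last by lia.
by rewrite (_ : (i < k <= j)%N = false) //; lia.
Qed.

Lemma lower_move w a b : valid_super m w -> inL a w -> inR a w -> ~ inL b w -> ~ inR b w ->
  b < a -> exists w', [/\ valid_super m w', super_gt m w w',
    (forall x, inL x w' <-> x = b \/ (inL x w /\ x <> a)) &
    (forall x, inR x w' <-> x = b \/ (inR x w /\ x <> a))].
Proof.
case: w => l s [/= sz [sl [is_ [N HN]]]] aL [j /= Ej] /negP bL bR ba.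
have [p [c [t [El ca sl']]]] := gt_sorted_split sl aL bL ba.
have ul : uniq l by apply: sorted_uniq sl => [|x]; [exact: gti_trans|exact: ltxx].
have ex : exists i, b < s i by exists j; rewrite Ej.
pose i := ex_minn ex.
have ij : (i <= j)%N by rewrite /i; case: ex_minnP => n _; apply; rewrite Ej.
have bi : b < s i by rewrite /i; case: ex_minnP.
have lo k : (k < i)%N -> s k < b.
  rewrite /i; case: ex_minnP => n _ nmin kn.
  have : s k <> b by move=> E; apply: bR; exists k.
  by case: (ltgtP b (s k)) => // [/nmin|E]; lia.
exists (Idx (p ++ c ++ b :: t) (upd (insert i j s) i b)); split.
- split; first by rewrite /= -sz El !size_cat /= !size_cat; lia.
  split=> //; split; first exact: incr_insert.
  exists (N + j).+1 => k le /=; rewrite /upd /insert.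
  rewrite (_ : (k == i) = false); last by lia.
  by rewrite (_ : (i < k <= j)%N = false); [apply: HN|]; lia.
- apply: clos_rt_t.
    by rewrite El; apply: bubble_lft ca; rewrite -El.
  apply: clos_rt_t.
    apply: (bubble_rgt (i := i) (j := j)) => //.
      by rewrite -sz El !size_cat /= !size_cat; lia.
    by move=> k Hk; rewrite incr_ltE //; lia.
  have := @lower_pair (absz (a - b)%R).-1 (size (p ++ c)) i (p ++ c ++ a :: t) (insert i j s).
  have -> : insert i j s i = a by rewrite /insert eqxx.
  rewrite catA nth_mid set_nth_mid (_ : a - _ = b); last by lia.
  rewrite -!catA; apply=> //; first by rewrite -sz El !size_cat /= !size_cat; lia.
  by rewrite -sz El !size_cat /= size_cat; lia.
- move=> x; rewrite /inL /= (@mem_swap_mid p c t a) -?El //; split.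
    by case/orP => [/eqP|/andP[xl /eqP]]; [left|right].
  by case=> [->|[-> /eqP ->]]; rewrite ?eqxx ?orbT.
- by move=> x; rewrite -Ej; apply: ran_insert.
Qed.

Lemma exists_maximum l : l != [::] -> exists2 b, b \in l & forall y, y \in l -> y <= b.
Proof.
elim: l => // x [|z l] IH _; first by exists x => [|y]; rewrite inE // => /eqP ->.
have [b bl Hb] := IH isT; exists (Num.max x b).
  by rewrite inE; case: leP; rewrite ?eqxx ?bl ?orbT.
by move=> y; rewrite inE le_max => /orP[/eqP ->|/Hb ->]; rewrite ?lexx ?orbT.
Qed.

Lemma perm_swap l l' (a b : int) : uniq l -> uniq l' -> a \in l -> b \notin l ->
  (forall x, (x \in l') = (x == b) || (x \in l) && (x != a)) ->
  forall P : pred int, (count P l' + P a = count P l + P b)%N.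
Proof.
move=> ul ul' al bl E P.
have /permP/(_ P) -> : perm_eq l' (b :: rem a l).
  apply: uniq_perm => //=; first by rewrite rem_uniq // andbT mem_rem_uniq // inE negb_and bl orbT.
  by move=> x; rewrite inE E mem_rem_uniq // inE andbC.
have /permP/(_ P) -> := perm_to_rem al.
by rewrite /= -addnA addnC [(_ + P a)%N]addnC.
Qed.

(* Each step lowers an entry of [lft f] missing from [lft g] to [b], the largest
   entry of [lft g] missing from [lft f]; the maximality of [b] keeps dominance. *)
Lemma dominance_super_gt f g : valid_plus m f -> valid_plus m g ->
  (forall x, mult x g = mult x f) ->
  (forall x : int, (count (fun y => x <= y)%R (lft g) <= count (fun y => x <= y)%R (lft f))%N) ->
  g = f \/ super_gt m (cmap f) (cmap g).
Proof.
move: {2}(count _ _).+1 (ltnSn (count (fun x => x \notin lft g) (lft f))) => n.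
elim: n f => // n IH f; rewrite ltnS => le vf vg E dom.
have [uf ug] := (valid_uniq vf, valid_uniq vg).
pose d := [seq x <- lft g | x \notin lft f].
case: (boolP (d == [::])) => [/eqP d0|/exists_maximum [b]].
  left; symmetry; apply: mult_lft_eq vg vf _ _ => [x|x xg]; first by rewrite E.
  apply/negPn/negP => xf; have : x \in d by rewrite mem_filter xf.
  by rewrite d0.
rewrite mem_filter => /andP[bf bg] bmax.
have {}bmax y : y \in lft g -> b < y -> y \in lft f.
  move=> yg lt; apply: contraTT lt => yf; rewrite -leNgt bmax // mem_filter yf yg //.
have [a /andP[af ag] ba] : exists2 a, (a \in lft f) && (a \notin lft g) & b < a.
  apply: NNPP => H; have := dom b; rewrite leqNgt => /negP; apply.
  rewrite -!size_filter; apply: (@uniq_leq_size _ (b :: [seq y <- lft f | b <= y])).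
    by rewrite /= mem_filter (negPf bf) andbF filter_uniq.
  move=> y; rewrite inE !mem_filter => /orP[/eqP ->|/andP[bey yf]]; first by rewrite lexx.
  rewrite bey /=; apply/negPn/negP => yg; apply: H; exists y; first by rewrite yf.
  rewrite lt_neqAle bey andbT; apply: contraNneq bf => ->; exact: yf.
have aR : ~ inR a f.
  by have := E a; rewrite /mult af (negPf ag); case: decP; case: decP.
have bR : inR b f.
  by have := E b; rewrite /mult bg (negPf bf); case: decP; case: decP.
have [|||w' [vw' lt EL ER]] := lower_move (valid_cmap vf) af _ _ _ ba.
- exact/(inR_cmap _ vf).
- exact/negP.
- exact/(inR_cmapN _ vf).
pose f' := cinv w'; have vf' : valid_plus m f' := valid_cinv vw'.
have Ef' : cmap f' = w' := cinvK vw'.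
have ELb x : (x \in lft f') = (x == b) || (x \in lft f) && (x != a).
  apply/idP/idP => [/EL [->|[-> /eqP ->]]|]; rewrite ?eqxx ?orbT //.
  by move=> H; apply/EL; move: H => /orP[/eqP|/andP[? /eqP]]; [left|right].
have ER' x : inR x f' <-> ~ (x = b \/ (~ inR x f /\ x <> a)).
  by rewrite -(inR_cmapN x vf') Ef' ER (inR_cmap x vf).
have sw := perm_swap uf (valid_uniq vf') af bf ELb.
have [|||gf|gt] := IH f' _ vf' vg.
- move: le; have := sw (fun x => x \notin lft g); rewrite ag bg /= addn0 addn1 => <-.
  exact.
- move=> x; rewrite E /mult ELb; have -> : dec (inR x f') = (x == a) || dec (inR x f) && (x != b).
    apply/decP/idP => [/ER' H|].
      case: (x =P a) => //= xa; case: (x =P b) => [xb|_]; first by case: H; left.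
      by rewrite andbT; apply/decP; apply: NNPP => nR; apply: H; right.
    move=> H; apply/ER' => -[xb|[nR xa]]; move: H.
      by rewrite xb eqxx andbF orbF => /eqP H; move: ba; rewrite H ltxx.
    by case/orP => [/eqP //|/andP[/decP]].
  case: (x =P a) => [->|xa].
    rewrite af (_ : (a == b) = false) ?andbF /=; last by move: ba; case: eqP => // ->; rewrite ltxx.
    by case: decP.
  case: (x =P b) => [->|xb]; first by rewrite (negPf bf) andbF; case: decP.
  by rewrite !andbT.
- move=> x; have := sw (fun y => x <= y).
  case: (boolP (b < x <= a)) => H; last first.
    have -> : (x <= a) = (x <= b) by lia.
    by move/addIn ->; apply: dom.
  have -> : (x <= a) = true by lia.
  have -> : (x <= b) = false by lia.
  rewrite addn0 addn1 => Ec; rewrite -ltnS Ec -!size_filter.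
  apply: (@uniq_leq_size _ (a :: [seq y <- lft g | x <= y])).
    by rewrite /= mem_filter (negPf ag) andbF filter_uniq.
  move=> y; rewrite inE !mem_filter => /orP[/eqP ->|/andP[xy yg]]; first by rewrite af andbT; lia.
  by rewrite xy; apply: bmax => //; lia.
- by right; rewrite gf Ef'.
by right; apply: t_trans lt _; rewrite -Ef'.
Qed.

Lemma bru_lt_super_gt f g : valid_plus m f -> valid_plus m g -> bru_lt m g f ->
  g <> f -> super_gt m (cmap f) (cmap g).
Proof.
move=> vf vg lt ne; have [_ [_ dom]] := bru_lt_inv lt.
by have [] := dominance_super_gt vf vg (fun x => bru_lt_mult x vg vf lt) dom.
Qed.
End SuperOrder.

(** * Compatibility with the bar involutions *)

Section Bar.
Variable m : nat.
Implicit Types (f g h w : idx) (u v : vec).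

Lemma Ehat_add u v : Ehat_plus m u -> Ehat_plus m v -> Ehat_plus m (vadd u v).
Proof.
move=> [su fu] [sv fv]; split; first exact: vadd_supp.
move=> n; have [l Hl] := fu n; have [l' Hl'] := fv n; exists (l ++ l') => f [nz tf].
apply/List.in_or_app; apply: NNPP => H; apply: nz; rewrite /vadd.
have -> : u f = 0 by apply: NNPP => uf; apply: H; left; apply: Hl.
have -> : v f = 0 by apply: NNPP => vf; apply: H; right; apply: Hl'.
exact: addr0.
Qed.

Lemma Ehat_scale c u : Ehat_plus m u -> Ehat_plus m (vscale c u).
Proof.
move=> [su fu]; split; first by move=> g /vscale_supp/su.
by move=> n; have [l Hl] := fu n; exists l => f [/vscale_supp nz tf]; apply: Hl.
Qed.

Definition vsub u v := vadd u (vscale (-1) v).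

Lemma vsubE u v f : vsub u v f = u f - v f.
Proof. by rewrite /vsub /vadd /vscale mulN1r. Qed.

Lemma vsubK u v : vadd (vsub u v) v = u.
Proof. by apply: functional_extensionality => f; rewrite /vadd vsubE subrK. Qed.

Lemma Ehat_sub u v : Ehat_plus m u -> Ehat_plus m v -> Ehat_plus m (vsub u v).
Proof. by move=> Hu Hv; apply: Ehat_add => //; apply: Ehat_scale. Qed.

Lemma tailV_mono n n' f : (n <= n')%N -> tailV n f -> tailV n' f.
Proof. by move=> le H j lj; apply: H; apply: leq_trans le lj. Qed.

Lemma offV_mono n n' u : (n <= n')%N -> offV n' u -> offV n u.
Proof. by move=> le H f /H nt /(tailV_mono le). Qed.

Variables (b1 b2 : vec -> vec).
Hypotheses (hb1 : is_bar_plus m b1) (hb2 : is_bar_super m b2).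

Definition intertwined u := Ehat_plus m u /\ natural (b1 u) = b2 (natural u).

Lemma intertwined_add u v : intertwined u -> intertwined v -> intertwined (vadd u v).
Proof.
move: hb1 hb2 => [E1 [D1 _]] [E2 [D2 _]] [Hu eu] [Hv ev]; split; first exact: Ehat_add.
have [E1u E1v] := (E1 _ Hu, E1 _ Hv).
have [Nu Nv] := (Ehat_natural Hu, Ehat_natural Hv).
by rewrite D1 // (naturalD Hu Hv) (naturalD E1u E1v) D2 // eu ev.
Qed.

Lemma intertwined_scale c u : intertwined u -> intertwined (vscale c u).
Proof.
move: hb1 hb2 => [E1 [_ [S1 _]]] [E2 [_ [S2 _]]] [Hu eu]; split; first exact: Ehat_scale.
by rewrite S1 // (naturalZ _ Hu) (naturalZ _ (E1 _ Hu)) S2 ?eu //; apply: Ehat_natural.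
Qed.

Lemma intertwined_sub u v : intertwined u -> intertwined v -> intertwined (vsub u v).
Proof. by move=> Iu Iv; apply: intertwined_add => //; apply: intertwined_scale. Qed.

Lemma intertwined_act X u : (forall a, X <> GK a) -> Ehat_plus m (act_plus X u) ->
  intertwined u -> intertwined (act_plus X u).
Proof.
move: hb1 hb2 => [E1 [_ [_ [_ [_ [A1 _]]]]]] [_ [_ [_ [_ [_ [A2 _]]]]]] nK HX [Hu eu].
split=> //; have [E1u _] := E1 _ Hu; have [su _] := Hu; have Nu := Ehat_natural Hu.
rewrite (natural_act X su); case: X nK HX => a nK HX; last by case: (nK a).
  have [-> _ _] := A1 u a Hu; have [-> _ _] := A2 _ a Nu.
  by rewrite (natural_act _ E1u) eu.
have [_ -> _] := A1 u a Hu; have [_ -> _] := A2 _ a Nu.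
by rewrite (natural_act _ E1u) eu.
Qed.

Lemma intertwined_closed u : Ehat_plus m u ->
  (forall n, exists2 v, intertwined v & offV n (vsub u v)) -> intertwined u.
Proof.
move: hb1 hb2 => [E1 [D1 [_ [C1 _]]]] [E2 [D2 [_ [C2 _]]]] Hu app; split=> //.
have [E1u _] := E1 _ Hu; have [E2u _] := E2 _ (Ehat_natural Hu).
apply: (natural_unique E1u E2u) => f vf.
have [_ [n' tf]] := valid_vsea vf.
have [n1 H1] := C1 n'; have [d H2] := C2 n'.
have [v [Hv ev] off] := app (n1 + d.+1)%N.
have Hw := Ehat_sub Hu Hv; move: off Hw; set w := vsub u v => off Hw.
have Nw := Ehat_natural Hw; have [E1w _] := E1 _ Hw; have [sw _] := Hw.
have bf : boundW n' (cmap f).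
  by move=> j; have := proj1 (tailV_cmap n' vf) tf j; lia.
have Z1 : b1 w f = 0.
  apply: NNPP => nz; have offw : offV n1 w by apply: offV_mono off; lia.
  by have := H1 w Hw offw f nz; apply.
have Z2 : b2 (natural w) (cmap f) = 0.
  apply: NNPP => nz; apply: (H2 _ Nw _ _ nz bf) => x /(natural_supp sw) [g wg ->] bg.
  apply: (off _ wg); apply: (@tailV_mono d.+1); first by lia.
  by apply/(tailV_cmap _ (sw _ wg)) => j; have := bg j; lia.
rewrite -(vsubK u v) -/w D1 // (naturalD Hw Hv) D2 //; last exact: Ehat_natural.
rewrite /vadd Z1 Z2 -ev (natural_cmap _ vf) //; by case: (E1 _ Hv).
Qed.

Lemma intertwined_typical f : valid_plus m f -> (forall x, inL x f -> inR x f) ->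
  intertwined (basis f).
Proof.
move: hb1 hb2 => [E1 [_ [_ [_ [_ [_ [_ T1]]]]]]] [_ [_ [_ [_ [T2 _]]]]] vf LR.
have Hf := basis_Ehat vf; split=> //.
have -> : b1 (basis f) = basis f.
  apply: functional_extensionality => g; have [d H] := T1 _ vf.
  case: (excluded_middle_informative (g = f)) => [->|ne]; first by rewrite d basisE.
  rewrite basis_neq //; apply: NNPP => nz; have [lt _] := H _ ne nz.
  have [sb _] := E1 _ Hf; apply: ne; exact: bru_lt_typical (sb _ nz) vf lt LR.
rewrite (natural_basis vf) T2 //; split; first exact: valid_cmap.
by move=> x /LR xR; rewrite (inR_cmap _ vf).
Qed.

Definition near n u := exists2 v, intertwined v & offV n (vsub u v).

Lemma near_sub n u v c : intertwined u -> near n v -> near n (vsub u (vscale c v)).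
Proof.
move=> Iu [v' Iv' off]; exists (vsub u (vscale c v')).
  by apply: intertwined_sub => //; apply: intertwined_scale.
move=> f nz; apply: off => E; apply: nz; move: E; rewrite !vsubE /vscale => E.
by rewrite opprB addrC addrA subrK -mulrBr -opprB E oppr0 mulr0.
Qed.

Lemma intertwined0 : intertwined vzero.
Proof.
have D0 (u : vec) : u = vadd u u -> u = vzero.
  move=> E; apply: functional_extensionality => f.
  by have := f_equal (@^~ f) E; rewrite /vadd /= -[LHS]addr0 => /addrI.
have V0 : vadd vzero vzero = vzero by apply: functional_extensionality => f; apply: addr0.
have H0 : Ehat_plus m vzero by split=> // n; exists [::] => f [].
have N0 : natural vzero = vzero by apply: D0; rewrite -(naturalD H0 H0) V0.
move: hb1 hb2 => [_ [D1 _]] [_ [D2 _]]; split=> //.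
have -> : b1 vzero = vzero by apply: D0; rewrite -D1 // V0.
by rewrite N0; symmetry; apply: D0; rewrite -D2 ?V0 // -N0; apply: Ehat_natural.
Qed.

Lemma near_off n u : offV n u -> near n u.
Proof.
move=> off; exists vzero; first exact: intertwined0.
by move=> f; rewrite vsubE subr0; apply: off.
Qed.

Lemma replLK x y f : ~ inL y f -> replL y x (replL x y f) = f.
Proof.
case: f => l r /negP ny; rewrite /replL /= -map_comp map_id_in // => z zl /=.
by case: (z =P x) => [->|_]; rewrite ?eqxx // (negPf (memPn ny _ zl)).
Qed.

Lemma replRK x y f : ~ inR y f -> replR y x (replR x y f) = f.
Proof.
case: f => l r ny; rewrite /replR /=; congr Idx; apply: functional_extensionality => k.
case: (r k =P x) => [->|_]; first by rewrite eqxx.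
by case: eqP => // E; case: ny; exists k.
Qed.

Lemma basis_step f a : valid_plus m f ->
  inL (a + 1) f -> ~ inR (a + 1) f -> ~ inL a f -> inR a f ->
  let g := replL (a + 1) a f in exists c,
  basis f = vsub (act_plus (GF a) (basis g)) (vscale c (basis (replR a (a + 1) g))).
Proof.
move=> vf l1 r1 l0 r0 g; exists (kV a (inL^~ g)); rewrite act_basis /actb_plus.
have Lg z : inL z g <-> z = a \/ (inL z f /\ z <> a + 1) by apply: inL_replL.
rewrite bvT; last by rewrite !Lg; split; [left|lia].
rewrite bvT // replLK //; apply: functional_extensionality => h.
by rewrite vsubE /vadd /vscale mul1r addrK.
Qed.

Lemma basis_raise_lft f a : inL (a + 1) f -> ~ inL a f -> ~ inR a f ->
  act_plus (GF a) (basis (replL (a + 1) a f)) = basis f.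
Proof.
move=> l1 l0 r0; rewrite act_basis /actb_plus.
have Lg z : inL z (replL (a + 1) a f) <-> z = a \/ (inL z f /\ z <> a + 1) by apply: inL_replL.
rewrite bvT; last by rewrite !Lg; split; [left|lia].
rewrite bvF /=; last by case.
rewrite replLK //; apply: functional_extensionality => h.
by rewrite /vadd /vscale mul1r addr0.
Qed.

Lemma basis_lower_rgt f a : inL (a + 1) f -> inL a f -> inR a f -> ~ inR (a + 1) f ->
  act_plus (GE a) (basis (replR a (a + 1) f)) = basis f.
Proof.
move=> l1 l0 r0 r1; rewrite act_basis /actb_plus.
have Rg z : inR z (replR a (a + 1) f) <-> z = a + 1 \/ (inR z f /\ z <> a) by apply: inR_replR.
rewrite bvT; last by rewrite !Rg; split; [left|lia].
rewrite bvF /=; last by case.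
rewrite replRK //; apply: functional_extensionality => h.
by rewrite /vadd /vscale mul1r addr0.
Qed.

Definition atyp f := count (fun x => ~~ dec (inR x f)) (lft f).

Lemma count_change1 (P Q : pred int) (l : seq int) x : uniq l -> x \in l ->
  (forall y, y != x -> P y = Q y) -> (count P l + Q x = count Q l + P x)%N.
Proof.
move=> ul xl E; have /permP H := perm_to_rem xl; rewrite !H /=.
rewrite (@eq_in_count _ P Q (rem x l)); first by rewrite addnC [(P x + _)%N]addnC addnA.
by move=> y; rewrite mem_rem_uniq // inE => /andP[/E].
Qed.

Lemma decT (P : Prop) : P -> dec P = true. Proof. by move=> p; apply/decP. Qed.
Lemma decF (P : Prop) : ~ P -> dec P = false. Proof. by move=> p; apply/decP. Qed.
Lemma dec_iff (P Q : Prop) : (P <-> Q) -> dec P = dec Q.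
Proof. by move=> PQ; apply/decP/decP => /PQ. Qed.

Lemma atyp_replL f a : valid_plus m f -> inL (a + 1) f -> ~ inL a f ->
  (atyp (replL (a + 1) a f) + ~~ dec (inR (a + 1) f) = atyp f + ~~ dec (inR a f))%N.
Proof.
move=> vf l1 l0; apply: perm_swap => //.
- exact: valid_uniq vf.
- by apply: (valid_uniq (m := m)); apply: valid_replL vf l0; apply: adjP.
- exact/negP.
- by move=> x; apply: mem_repl => //; apply/negP.
Qed.

Lemma atyp_replR f a : valid_plus m f -> inL a f -> inR a f -> ~ inR (a + 1) f ->
  atyp (replR a (a + 1) f) = (atyp f + (a + 1 \notin lft f)%R)%N.
Proof.
move=> vf l0 r0 r1; have uf := valid_uniq vf; rewrite /atyp.
set Q := fun x => _; set P := fun x => _.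
have Rg z : inR z (replR a (a + 1) f) <-> z = a + 1 \/ (inR z f /\ z <> a) by apply: inR_replR.
have QE x : x != a -> x != a + 1 -> Q x = P x.
  move=> /eqP xa /eqP xa1; rewrite /Q /P; congr (~~ _); apply: dec_iff; rewrite Rg; tauto.
pose P' x := (x == a) || P x.
have Pa : P a = false by rewrite /P decT.
have Pa1 : P (a + 1) = true by rewrite /P decF.
have Qa : Q a = true by rewrite /Q decF // Rg; lia.
have Qa1 : Q (a + 1) = false by rewrite /Q decT // Rg; left.
have E1 : count P' (lft f) = (count P (lft f)).+1.
  have : (count P' (lft f) + P a = count P (lft f) + P' a)%N.
    by apply: count_change1 => // y /negPf ya; rewrite /P' ya.
  by rewrite Pa /P' eqxx /= addn0 addn1.
have QP' y : y != a + 1 -> Q y = P' y.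
  by move=> ny; rewrite /P'; case: (y =P a) => [->|/eqP ya] //=; apply: QE.
case: (boolP (a + 1 \in lft f)) => l1 /=.
  have := count_change1 uf l1 QP'; rewrite Qa1 /P' Pa1 orbT addn0 addn1 -/P' E1 addn0.
  by move=> /succn_inj ->.
rewrite addn1 -E1; apply: eq_in_count => y yl; apply: QP'.
by apply: contraNneq l1 => <-.
Qed.

Section Induction.
Variable k : nat.
Hypothesis IHk : forall g, valid_plus m g -> (atyp g < k)%N -> intertwined (basis g).

Definition next f a := replR a (a + 1) (replL (a + 1) a f).

Lemma nextP f a : valid_plus m f -> inL (a + 1) f -> ~ inR (a + 1) f -> ~ inL a f -> inR a f ->
  [/\ valid_plus m (next f a), atyp (next f a) = atyp f,
      forall x, inL x (next f a) <-> x = a \/ (inL x f /\ x <> a + 1) &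
      forall x, inR x (next f a) <-> x = a + 1 \/ (inR x f /\ x <> a)].
Proof.
move=> vf l1 r1 l0 r0; have vg := valid_replL (adjP a) vf l0.
have Lg x : inL x (next f a) <-> x = a \/ (inL x f /\ x <> a + 1) by apply: inL_replL.
have Rg x : inR x (next f a) <-> x = a + 1 \/ (inR x f /\ x <> a) by apply: inR_replR.
split=> //; first by apply: valid_replR (adjS a) vg _.
have := atyp_replL vf l1 l0; rewrite (decF r1) (decT r0) /= addn0 addn1 => <-.
have ng : ~ inL (a + 1) (replL (a + 1) a f) by rewrite inL_replL //; lia.
rewrite atyp_replR //; last by rewrite inL_replL //; left.
by move/negP: ng => ->; rewrite addn1.
Qed.

Lemma basis_next f a : valid_plus m f -> (atyp f <= k)%N ->
  inL (a + 1) f -> ~ inR (a + 1) f -> ~ inL a f -> inR a f ->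
  exists2 u, intertwined u & exists c, basis f = vsub u (vscale c (basis (next f a))).
Proof.
move=> vf le l1 r1 l0 r0; have vg := valid_replL (adjP a) vf l0.
have [vn _ _ _] := nextP vf l1 r1 l0 r0.
have [c E] := basis_step vf l1 r1 l0 r0.
exists (act_plus (GF a) (basis (replL (a + 1) a f))); last by exists c.
apply: intertwined_act => //.
  rewrite (_ : act_plus _ _ = vadd (basis f) (vscale c (basis (next f a)))).
    by apply: Ehat_add; [|apply: Ehat_scale]; apply: basis_Ehat.
  apply: functional_extensionality => h; have := f_equal (@^~ h) E.
  by rewrite vsubE /= /vadd => ->; rewrite subrK.
apply: IHk => //; apply: leq_trans le.
by have := atyp_replL vf l1 l0; rewrite (decF r1) (decT r0) /= addn0 addn1 => <-.
Qed.

(* Below [a] everything is in the sea, so [basis_next] can be iterated for ever;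
   the error term then has a hole at [a + 1], [a], [a - 1], ... and tends to 0. *)
Lemma near_sea f a n : valid_plus m f -> (atyp f <= k)%N ->
  inL (a + 1) f -> ~ inR (a + 1) f -> (forall x, x <= a -> inR x f /\ ~ inL x f) ->
  near n (basis f).
Proof.
have [t] : exists t : nat, a + n%:Z < t%:Z by exists (absz (a + n%:Z)%R).+1; lia.
elim: t a f => [|t IH] a f at_ vf le l1 r1 sea.
  apply: near_off => g /basis_supp -> /(tailVE n vf) /(_ (a + 1)) H; apply: r1; apply: H; lia.
have [r0 l0] := sea a (lexx a).
have [vn An Ln Rn] := nextP vf l1 r1 l0 r0.
have [u Iu [c ->]] := basis_next vf le l1 r1 l0 r0.
apply: near_sub => //; apply: (IH (a - 1)); rewrite ?subrK ?An //.
- by move: at_; lia.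
- by rewrite Ln; left.
- by rewrite Rn; lia.
move=> x xa; have [xr xl] : inR x f /\ ~ inL x f by apply: sea; lia.
rewrite Ln Rn.
by split; [right; split=> //; lia|move=> [|[]] //; lia].
Qed.

Lemma intertwined_atypical t f a : valid_plus m f -> (atyp f <= k)%N ->
  inL (a + 1) f -> ~ inR (a + 1) f -> (forall x, x <= a -> inL x f -> inR x f) ->
  (forall x, x <= a - t%:Z -> inR x f /\ ~ inL x f) -> intertwined (basis f).
Proof.
elim: t a f => [|t IH] a f vf le l1 r1 min sea.
  apply: intertwined_closed; first exact: basis_Ehat.
  by move=> n; apply: near_sea vf le l1 r1 _ => x xa; apply: sea; lia.
case: (excluded_middle_informative (inR a f)) => r0; last first.
  have l0 : ~ inL a f by move=> al; apply: r0; apply: min (lexx a) al.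
  have vg := valid_replL (adjP a) vf l0.
  have Lg x : inL x (replL (a + 1) a f) <-> x = a \/ (inL x f /\ x <> a + 1) by apply: inL_replL.
  have E := basis_raise_lft l1 l0 r0.
  rewrite -E; apply: intertwined_act => //; first by rewrite E; apply: basis_Ehat.
  apply: (IH (a - 1)); rewrite ?subrK //.
  - by have := atyp_replL vf l1 l0; rewrite (decF r1) (decF r0) /= => /addIn ->.
  - by rewrite Lg; left.
  - by move=> x xa; rewrite Lg => -[|[xl _]]; [lia|apply: min xl; lia].
  - move=> x xa; have [xr xl] : inR x f /\ ~ inL x f by apply: sea; lia.
    by rewrite Lg; split=> // -[|[]] //; lia.
case: (excluded_middle_informative (inL a f)) => l0.
  have vg := valid_replR (adjS a) vf r1.
  have Rg x : inR x (replR a (a + 1) f) <-> x = a + 1 \/ (inR x f /\ x <> a) by apply: inR_replR.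
  have E := basis_lower_rgt l1 l0 r0 r1.
  rewrite -E; apply: intertwined_act => //; first by rewrite E; apply: basis_Ehat.
  apply: (IH (a - 1)); rewrite ?subrK //.
  - by rewrite atyp_replR // (_ : (a + 1 \notin lft f) = false) ?addn0 //; apply/negPn.
  - by rewrite Rg; lia.
  - by move=> x xa xl; rewrite Rg; right; split; [apply: min xl|]; lia.
  - move=> x xa; have [xr xl] : inR x f /\ ~ inL x f by apply: sea; lia.
    by rewrite Rg; split=> //; right; split=> //; lia.
have [vn An Ln Rn] := nextP vf l1 r1 l0 r0.
have [u Iu [c ->]] := basis_next vf le l1 r1 l0 r0.
apply: intertwined_sub => //; apply: intertwined_scale.
apply: (IH (a - 1)); rewrite ?subrK ?An //.
- by rewrite Ln; left.
- by rewrite Rn; lia.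
- by move=> x xa; rewrite Ln Rn => -[|[xl _]]; [lia|right; split; [apply: min xl|]; lia].
- move=> x xa; have [xr xl] : inR x f /\ ~ inL x f by apply: sea; lia.
  by rewrite Ln Rn; split; [right; split=> //; lia|move=> [|[]] //; lia].
Qed.
End Induction.

Lemma sea_bound f : valid_plus m f -> exists N : nat, forall x, x <= - N%:Z ->
  inR x f /\ ~ inL x f.
Proof.
move=> vf; have [_ [N HN]] := valid_vsea vf.
have [M HM] : exists M : nat, forall x, x \in lft f -> - M%:Z < x.
  elim: (lft f) => [|y l [M HM]]; first by exists 0%N.
  by exists (M + absz y).+1 => x; rewrite inE => /orP[/eqP ->|/HM]; lia.
exists (N + M)%N => x xN; split; last by move=> /HM; lia.
by apply/(proj1 (tailVE N vf)) => //; lia.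
Qed.

Lemma intertwined_basis f : valid_plus m f -> intertwined (basis f).
Proof.
move: {2}(atyp f).+1 (ltnSn (atyp f)) => k; elim: k f => // k IH f; rewrite ltnS => le vf.
pose d := [seq - x | x <- lft f & ~~ dec (inR x f)].
case: (boolP (d == [::])) => [/eqP d0|/exists_maximum [b /mapP[a]]].
  apply: intertwined_typical => // x xf; apply: NNPP => nR.
  have : - x \in d by apply: map_f; rewrite mem_filter (decF nR).
  by rewrite d0.
rewrite mem_filter => /andP[/negP ar al] -> amax.
have [N HN] := sea_bound vf.
apply: (@intertwined_atypical k _ (N + absz a) f (a - 1)); rewrite ?subrK //.
- by move=> g vg lt; apply: IH.
- by move=> /decP.
- move=> x xa xl; apply: NNPP => nR.
  have : - x <= - a by apply: amax; apply: map_f; rewrite mem_filter (decF nR).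
  lia.
- by move=> x xa; apply: HN; lia.
Qed.

Lemma intertwined_finite u (l : seq idx) : Ehat_plus m u ->
  exists v, [/\ intertwined v, (forall f, f \in l -> v f = u f) &
    forall f, v f = u f \/ v f = 0].
Proof.
move=> [su _]; elim: l => [|f l [v [Iv vl v0]]].
  by exists vzero; split=> //; [exact: intertwined0|move=> f; right].
case: (excluded_middle_informative (v f = u f)) => vf.
  by exists v; split=> // g; rewrite inE => /orP[/eqP ->|/vl].
have vf0 : v f = 0 by case: (v0 f).
have validf : valid_plus m f by apply: su => uf; apply: vf; rewrite uf vf0.
exists (vadd v (vscale (u f) (basis f))).
have Ef : vadd v (vscale (u f) (basis f)) f = u f by rewrite /vadd /vscale vf0 basisE mulr1 add0r.
have Eg g : g <> f -> vadd v (vscale (u f) (basis f)) g = v g.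
  by move=> ne; rewrite /vadd /vscale basis_neq // mulr0 addr0.
split.
- by apply: intertwined_add => //; apply: intertwined_scale; apply: intertwined_basis.
- by move=> g; case: (g =P f) => [-> //|ne]; rewrite inE => /orP[/eqP //|/vl]; rewrite Eg.
- by move=> g; case: (g =P f) => [->|ne]; [left|rewrite Eg].
Qed.

Lemma natural_bar u : Ehat_plus m u -> natural (b1 u) = b2 (natural u).
Proof.
move=> Hu; suff [] : intertwined u by [].
apply: intertwined_closed => // n; have [_ fu] := Hu; have [l Hl] := fu n.
have [v [Iv vl v0]] := intertwined_finite l Hu; exists v => // f nz tf; apply: (nz).
rewrite vsubE; suff -> : v f = u f by rewrite subrr.
case: (v0 f) => // v0f; apply: vl; apply/InP/Hl; split=> // uf.
by apply: nz; rewrite vsubE uf v0f subrr.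
Qed.

End Bar.

Lemma natural_canonical m b1 b2 (S : K -> Prop) f x :
  is_bar_plus m b1 -> is_bar_super m b2 -> valid_plus m f ->
  [/\ Ehat_plus m x, b1 x = x, x f = 1 &
      forall g, g <> f -> x g <> 0 -> bru_lt m g f /\ S (x g)] ->
  [/\ Ehat_super m (natural x), b2 (natural x) = natural x, natural x (fnat f) = 1 &
      forall g, g <> fnat f -> natural x g <> 0 -> super_gt m (fnat f) g /\ S (natural x g)].
Proof.
move=> hb1 hb2 vf [Hx bx xf H]; have [sx _] := Hx; split.
- exact: Ehat_natural.
- by rewrite -(natural_bar hb1 hb2 Hx) bx.
- by rewrite (fnat_cmap vf) (natural_cmap sx vf).
move=> w nf /[dup] nz /(natural_supp sx) [g xg Ew]; have vg := sx _ xg.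
rewrite (fnat_cmap vf) Ew in nf *; rewrite (natural_cmap sx vg).
have gf : g <> f by move=> E; apply: nf; rewrite E.
by have [lt Sg] := H g gf xg; split=> //; apply: bru_lt_super_gt.
Qed.

Theorem theorem6p7 (m : nat) :
  (* natural is a well-defined bijection \hat E^{m+oo} -> \hat E^{m|oo} *)
  (forall u, Ehat_plus m u -> Ehat_super m (natural u)) /\
  (forall u v, Ehat_plus m u -> Ehat_plus m v -> natural u = natural v -> u = v) /\
  (forall w, Ehat_super m w -> exists u, Ehat_plus m u /\ natural u = w) /\
  (* ... which is Q(q)-linear ... *)
  (forall u v, Ehat_plus m u -> Ehat_plus m v ->
     natural (vadd u v) = vadd (natural u) (natural v)) /\
  (forall c u, Ehat_plus m u -> natural (vscale c u) = vscale c (natural u)) /\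
  (* ... and a homomorphism of U-modules *)
  (forall X u, Ehat_plus m u -> natural (act_plus X u) = act_super X (natural u)) /\
  (* (1) *)
  (forall f, valid_plus m f -> natural (basis f) = basis (fnat f)) /\
  (* (2) *)
  (forall b1 b2, is_bar_plus m b1 -> is_bar_super m b2 ->
     forall u, Ehat_plus m u -> natural (b1 u) = b2 (natural u)) /\
  (* (3) *)
  (forall b1 b2, is_bar_plus m b1 -> is_bar_super m b2 ->
     forall f x, valid_plus m f -> isL_plus m b1 f x ->
       isL_super m b2 (fnat f) (natural x)) /\
  (* (4) *)
  (forall b1 b2, is_bar_plus m b1 -> is_bar_super m b2 ->
     forall f x, valid_plus m f -> isU_plus m b1 f x ->
       isU_super m b2 (fnat f) (natural x)).
Proof.
split; first exact: Ehat_natural.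
split; first exact: natural_inj.
split; first exact: natural_surj.
split; first exact: naturalD.
split; first by move=> c u; exact: naturalZ.
split; first by move=> X u [su _]; exact: (natural_act (m := m)).
split; first by move=> f vf; rewrite (natural_basis vf) (fnat_cmap vf).
split; first by move=> b1 b2 hb1 hb2 u; exact: natural_bar.
by split=> b1 b2 hb1 hb2 f x vf; apply: natural_canonical hb1 hb2 vf.
Qed.
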